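(* Fix a small constant $\varepsilon>0$ (with $\varepsilon<2^{-1/2}$). For each $n$, let $X$ and $Y$ be independently chosen random graphs in $\mathcal G(n,p)$, where $p=p(n)\in[0,1]$ depends on $n$. (1) If $p(n)\leq\dfrac{2^{-1/2}-\varepsilon}{n^{1/2}}$ for all $n$, then $\mathsf{FS}(X,Y)$ is disconnected with high probability. (2) If $p(n)\geq\dfrac{\exp(2(\log n)^{2/3})}{n^{1/2}}$ for all (sufficiently large) $n$, then $\mathsf{FS}(X,Y)$ is connected with high probability.
   Context: All graphs are simple. For graphs $X$ and $Y$ with $|V(X)|=|V(Y)|=n$, the friends-and-strangers graph $\mathsf{FS}(X,Y)$ is the graph whose vertices are all bijections $\sigma:V(X)\to V(Y)$, where two bijections $\sigma,\sigma'$ are adjacent if and only if there is an edge $\{a,b\}\in E(X)$ such that $\{\sigma(a),\sigma(b)\}\in E(Y)$, $\sigma(a)=\sigma'(b)$, $\sigma(b)=\sigma'(a)$, and $\sigma(c)=\sigma'(c)$ for all $c\in V(X)\setminus\{a,b\}$. $\mathcal G(n,p)$ is the probability space of Erdős–Rényi random graphs on $n$ vertices, in which each edge of $K_n$ appears independently with probability $p$. An event occurs with high probability if its probability tends to $1$ as $n\to\infty$. $\log$ is the natural logarithm. *)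

(* Defs.v *)
From HB Require Import structures.
From mathcomp Require Import all_boot all_order all_algebra.
From mathcomp Require Import all_fingroup.
From mathcomp Require Import all_classical all_reals all_analysis.

Set Implicit Arguments.
Unset Strict Implicit.
Unset Printing Implicit Defensive.

Import Order.TTheory GRing.Theory Num.Theory.
Import numFieldNormedType.Exports.

Local Open Scope ring_scope.

Section Graphs.
Variable T : finType.

Definition pairs : {set {set T}} := [set e : {set T} | #|e| == 2%N].

Record sgraph := SGraph {
  edges :> {set {set T}};
  edges_pairs : edges \subset pairs
}.

HB.instance Definition _ := [isSub for edges].
HB.instance Definition _ := [Finite of sgraph by <:].

(* Irreflexive, since [set x; x] has cardinality 1. *)
Definition adj (G : sgraph) : rel T := fun x y => [set x; y] \in edges G.

(* Graphs on a common vertex set T, so that the bijections from V(X) to V(Y)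
   are the permutations of T. *)
Definition FS (X Y : sgraph) : rel {perm T} := fun s s' =>
  [exists a, exists b,
    [&& adj X a b, adj Y (s a) (s b), s a == s' b, s b == s' a
      & [forall c, (c != a) && (c != b) ==> (s c == s' c)]]].

Definition FS_connected (X Y : sgraph) : bool :=
  [forall s, forall s', connect (FS X Y) s s'].

End Graphs.

(* The probability that the outcome of G(n, p) is G: independently, each pair
   is an edge with probability p and a non-edge with probability 1 - p. *)
Definition gnp (R : realType) (n : nat) (p : R) (G : sgraph 'I_n) : R :=
  \prod_(e in pairs 'I_n) (if e \in edges G then p else 1 - p).

(* The probability of Q X Y for independent X and Y drawn from G(n, p). *)
Definition gnp_prob2 (R : realType) (n : nat) (p : R) (Q : rel (sgraph 'I_n))
    : R :=
  \sum_(X : sgraph 'I_n) \sum_(Y : sgraph 'I_n | Q X Y) gnp p X * gnp p Y.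

Lemma gnp_sum1 (R : realType) (n : nat) (p : R) :
  \sum_(G : sgraph 'I_n) gnp p G = 1.
Proof.
pose F e := if e \in pairs 'I_n then p else 0.
pose F' e := if e \in pairs 'I_n then 1 - p else 1.
transitivity (\prod_(e : {set 'I_n}) (F e + F' e)); last first.
  by apply: big1 => e _; rewrite /F /F'; case: ifP => _; rewrite ?subrKC ?add0r.
rewrite bigA_distr (bigID (fun A : {set {set 'I_n}} => A \subset pairs 'I_n)) /=.
rewrite [X in _ + X]big1 ?addr0; last first.
  move=> A /subsetPn[e eA eP].
  by rewrite (bigD1 e) //= eA /F (negPf eP) mul0r.
rewrite (reindex_omap (@edges 'I_n) insub) /=; last first.
  by move=> A sA; rewrite insubT.
apply: eq_big => [G|G _]; first by rewrite (valK G) eqxx andbT edges_pairs.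
rewrite /gnp big_mkcond; apply: eq_bigr => e _; rewrite /F /F'.
case: (boolP (e \in pairs _)) => // eP.
by case: ifP => // /(fintype.subsetP (edges_pairs G)); rewrite (negPf eP).
Qed.

Lemma gnp_prob2T (R : realType) (n : nat) (p : R) :
  gnp_prob2 p (fun _ _ : sgraph 'I_n => true) = 1.
Proof.
rewrite /gnp_prob2; under eq_bigr do rewrite -mulr_sumr gnp_sum1 mulr1.
exact: gnp_sum1.
Qed.

(* Main.v *)
Require Import Defs.
From mathcomp Require Import all_boot all_order all_algebra.
From mathcomp Require Import all_fingroup.
From mathcomp Require Import all_classical all_reals all_analysis.
From mathcomp Require Import fintype finset bigop.
From mathcomp Require Import zify ring lra.

Set Implicit Arguments.
Unset Strict Implicit.
Unset Printing Implicit Defensive.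

Import Order.TTheory GRing.Theory Num.Theory.
Import numFieldNormedType.Exports.

(** A permutation [f] of the vertices is read as a placement: [f x] is the
    person (a vertex of [Y]) who stands at position [x] (a vertex of [X]), and a
    move swaps two friends who stand at adjacent positions.

    Sparse case. By an exponential moment bound, with high probability all
    degrees of [X] and [Y] are below [sqrt (n / 2)] (lemma [gnp_degree]). Two
    graphs with such degrees can be packed (lemma [sauer_spencer]): some
    placement makes no two friends adjacent, so it has no move at all and
    [FS X Y] is disconnected.

    Dense case. The argument uses only that [n p^2] is at least a large multiple
    of [ln n]. It suffices that from every placement [f] and for all positions
    [x != y] the persons at [x] and [y] can trade places
    ([FS_connected_exchange]). To this end look at a third position [c] and at
    the set [W] of persons standing on neighbours of [c]. It is essentially a
    random set of about [n p] persons, so the graph of friendships within it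
    is a random graph of average degree about [n p^2], and very likely
    [robust]: it stays connected after the deletion of a few persons, and it is
    far from bipartite. The moves along the edges at [c] form a sliding puzzle:
    the person at [c] acts as the blank, which wanders along friendships within
    [W]. As for Wilson's theorem on such puzzles, all arrangements of the
    persons involved are reachable ([slides_all]); a 3-cycle of persons comes
    from the commutator of two rotations around cycles that share a single edge
    at the blank, connectivity transports it to any three persons, and an odd
    closed walk provides an odd permutation. If moreover [x] and [y] each have
    a neighbour on the star around [c], then the persons at [x] and [y] can be
    traded for their friends one at a time, and hence for each other
    ([FS_exchange]).

    It remains to find such a [c] for all placements at once. Splitting every
    edge of [X] into two arcs represents [X] as the underlying graph of a random
    digraph whose out-neighbourhoods are independent random sets ([gnp_arcs]).
    Once the out-neighbourhoods of [x] and [y] are fixed, the trials at the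
    [n - 2] other positions [c] are independent. For all but few graphs [Y]
    (Markov's inequality) each trial fails with probability at most [n^-4], so
    that all of them fail with probability at most [n^(-4 (n - 2))], which
    outweighs the at most [n^(n + 2)] choices of [f], [x] and [y]
    ([gnp_prob2_disconnected_le]). *)

(** * Moves *)

Section StarPuzzle.
Variables (T : finType) (X Y : sgraph T).
Implicit Types (f g q : {perm T}) (p h r : T) (R D Z : {set T}) (w : seq T).

Lemma adjC (G : sgraph T) : symmetric (adj G).
Proof. by move=> a b; rewrite /adj setUC. Qed.

Lemma adj_neq (G : sgraph T) a b : adj G a b -> a != b.
Proof.
move=> ab; apply/eqP=> eq_ab; move: ab; rewrite /adj eq_ab setUid => bG.
by have := subsetP (edges_pairs G) _ bG; rewrite inE cards1.
Qed.

Lemma FS_swap (f : {perm T}) a b : adj X a b -> adj Y (f a) (f b) ->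
  FS X Y f (f * tperm (f a) (f b))%g.
Proof.
move=> Xab Yab; apply/existsP; exists a; apply/existsP; exists b.
rewrite Xab Yab !permM tpermL tpermR !eqxx /=.
apply/forallP=> z; apply/implyP=> /andP[za zb].
by rewrite permM tpermD // (inj_eq perm_inj) eq_sym.
Qed.

(** * The sliding puzzle on a star *)

Section Wilson.
Variables (c : T) (S : {set T}).
Hypothesis cS : c \notin S.

(** Moves along the edges that join the centre [c] to the leaves [S] of a star of
    [X]. The person at [c] is the blank of the puzzle: it moves on the graph [Y]
    by trading places with friends. *)
Definition slide : rel {perm T} := fun f g =>
  [exists r, [&& adj Y (f c) r, (f^-1)%g r \in S & g == (f * tperm (f c) r)%g]].

Lemma slide_tperm f r :
  adj Y (f c) r -> (f^-1)%g r \in S -> slide f (f * tperm (f c) r)%g.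
Proof. by move=> Yr rS; apply/existsP; exists r; rewrite Yr rS eqxx. Qed.

Lemma slide_sym : symmetric slide.
Proof.
suff imp f g : slide f g -> slide g f by move=> f g; apply/idP/idP; apply: imp.
case/existsP=> r /and3P[Yr rS /eqP->]; apply/existsP; exists (f c).
rewrite permM tpermL adjC Yr invMg tpermV permM tpermL rS /=.
by rewrite -mulgA tpermC -{1}(mulg1 f) eq_sym; apply/eqP; rewrite tperm2.
Qed.

Lemma slides_sym f g : connect slide f g = connect slide g f.
Proof. exact/sym_connect_sym/slide_sym. Qed.

Lemma slides_FS f g : (forall z, z \in S -> adj X c z) ->
  connect slide f g -> connect (FS X Y) f g.
Proof.
move=> XS; apply: connect_sub => {}f {}g /existsP[r /and3P[Yr rS /eqP->]].
apply: connect1; have := @FS_swap f c ((f^-1)%g r); rewrite permKV; apply=> //.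
exact: XS.
Qed.

(** The leaves of a star are interchangeable, so permuting the leaves beforehand
    does not affect which blank walks are possible. *)
Lemma slides_mul q f g : perm_on S q ->
  connect slide f g -> connect slide (q * f)%g (q * g)%g.
Proof.
move=> qS; have qc : q c = c by exact: out_perm cS.
have qVS : perm_on S q^-1%g by rewrite perm_onV.
case/connectP=> w; elim: w f g => [|f' w IH] f g /=; first by move=> _ ->; exact: connect0.
case/andP=> ff' wf' ->; apply: connect_trans (IH f' _ wf' erefl).
apply: connect1; case/existsP: ff' => r /and3P[Yr rS /eqP->].
apply/existsP; exists r; rewrite permM qc Yr invMg permM -mulgA eqxx andbT.
by rewrite perm_closed.
Qed.

Definition star_holds (R : {set T}) (f : {perm T}) :=
  forall z, (f z \in R) = (z \in c |: S).

Lemma star_holdsV R (f : {perm T}) : star_holds R f ->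
  forall r, ((f^-1)%g r \in c |: S) = (r \in R).
Proof. by move=> fR r; rewrite -fR permKV. Qed.

Lemma star_holds_blank R f : star_holds R f -> f c \in R.
Proof. by move->; rewrite setU11. Qed.

Lemma slides_off f g : connect slide f g ->
  forall z, z \notin c |: S -> g z = f z.
Proof.
case/connectP=> w; elim: w f g => [|f' w IH] f g /=; first by move=> _ ->.
case/andP=> ff' wf' -> z zS; rewrite (IH f' _ wf' erefl z zS) {IH wf'}.
case/existsP: ff' => r /and3P[Yr rS /eqP->]; rewrite permM tpermD //.
  by rewrite (inj_eq perm_inj); apply: contraNneq zS => <-; rewrite setU11.
by apply: contraNneq zS => rz; rewrite -[z](permK f) -rz inE rS orbT.
Qed.

Lemma slides_holds R f g : connect slide f g -> star_holds R f -> star_holds R g.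
Proof.
case/connectP=> w; elim: w f g => [|f' w IH] f g /=; first by move=> _ ->.
case/andP=> ff' wf' -> fR; apply: (IH f' _ wf' erefl) => z {IH wf'}.
case/existsP: ff' => r /and3P[Yr rS /eqP->]; rewrite permM.
have rR : r \in R by rewrite -(star_holdsV fR) inE rS orbT.
by rewrite -fR; case: tpermP => [->|->|//]; rewrite ?rR ?(star_holds_blank fR).
Qed.

Definition induced (D : {set T}) : rel T :=
  [rel a b | [&& a \in D, b \in D & adj Y a b]].

Lemma induced_sym D : symmetric (induced D).
Proof. by move=> a b; rewrite /induced /= adjC; case: (a \in D); rewrite ?andbF. Qed.

Definition linked (D : {set T}) := {in D &, forall a b, connect (induced D) a b}.

(** The effect on the persons of a blank that starts at [h] and visits [w]. *)
Fixpoint walk_perm (h : T) (w : seq T) : {perm T} :=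
  if w is r :: w' then (tperm h r * walk_perm r w')%g else 1%g.

Lemma walk_perm_rcons h w r :
  walk_perm h (rcons w r) = (walk_perm h w * tperm (last h w) r)%g.
Proof. by elim: w h => [|a w IH] h /=; rewrite ?mulg1 ?mul1g // IH mulgA. Qed.

Lemma walk_perm_last h w : walk_perm h w h = last h w.
Proof. by elim: w h => [|a w IH] h /=; rewrite ?perm1 // permM tpermL IH. Qed.

Lemma walk_perm_out h w z : z \notin h :: w -> walk_perm h w z = z.
Proof.
elim: w h => [|a w IH] h; first by rewrite perm1.
rewrite !inE !negb_or => /and3P[zh za zw]; rewrite permM tpermD 1?eq_sym //.
by apply: IH; rewrite inE negb_or za.
Qed.

Lemma walk_perm_odd D h w : path (induced D) h w -> odd_perm (walk_perm h w) = odd (size w).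
Proof.
elim: w h => [|a w IH] h /=; first by rewrite odd_perm1.
case/andP=> /and3P[_ _ /adj_neq ha] wP.
by rewrite odd_mul_tperm ha IH.
Qed.

Lemma slides_walk R f w : star_holds R f -> path (induced R) (f c) w ->
  connect slide f (f * walk_perm (f c) w)%g.
Proof.
elim: w f => [|r w IH] f fR /=; first by rewrite mulg1 connect0.
case/andP=> /and3P[fcR rR Yr] wP.
have rS : (f^-1)%g r \in S.
  have := star_holdsV fR r; rewrite rR inE in_set1 => /orP[/eqP fr|//].
  by have := adj_neq Yr; rewrite -fr permKV eqxx.
have ff' := slide_tperm Yr rS; apply: connect_trans (connect1 ff') _.
have := IH _ (slides_holds (connect1 ff') fR).
by rewrite permM tpermL -mulgA; apply.
Qed.

(** The blank reaches every vertex of a connected part [D] of the puzzle, and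
    disturbs nobody outside of [D]. *)
Lemma slides_linked R D f h : star_holds R f -> D \subset R -> linked D ->
  f c \in D -> h \in D -> exists g,
  [/\ connect slide f g, g c = h & forall z, f z \notin D -> g z = f z].
Proof.
move=> fR sDR Dl fcD hD; have /connectP[w wP wl] := Dl _ _ fcD hD.
have wR : path (induced R) (f c) w.
  apply: sub_path wP => a b /and3P[aD bD Yab].
  by apply/and3P; rewrite !(subsetP sDR).
exists (f * walk_perm (f c) w)%g; split; first exact: slides_walk wR.
  by rewrite permM walk_perm_last.
move=> z zD; rewrite permM walk_perm_out //; apply: contra zD.
rewrite inE => /predU1P[->//|]; move: (f c) wP {wl wR fcD} => a.
elim: w a => [//|b w IH] a /= /andP[/and3P[aD bD _] wP].
by rewrite inE => /predU1P[->//|]; apply: IH wP.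
Qed.

(** Three deletions leave room to carry one leaf around while two others stay in
    place: the two fixed ones and the travelling one are the obstacles of the
    blank. Nine vertices leave room for three auxiliary places when three leaves
    are carried to three targets. *)
Definition sturdy (R : {set T}) :=
  (8 < #|R|)%N /\ forall Z : {set T}, (#|Z| <= 3)%N -> linked (R :\: Z).

(** The leaf [p] is carried along a path that avoids the locked persons [Z]: to
    advance one step, first bring the blank to the next vertex of the path, by
    a route that avoids [Z] and the current vertex, and then slide. *)
Lemma slides_token R f p Z h : star_holds R f -> sturdy R -> (#|Z| <= 2)%N ->
  p \in S -> f p \notin Z -> f c \notin Z -> h \in R :\: Z -> exists g,
  [/\ connect slide f g, g p = h & forall z, f z \in Z -> g z = f z].
Proof.
move=> fR [_ sR] Z2 pS fpZ fcZ hR.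
have fpR : f p \in R :\: Z by rewrite inE fpZ fR !inE pS orbT.
have pc : p != c by apply: contraNneq cS => <-.
have : connect (induced (R :\: Z)) (f p) h by apply: sR fpR hR; lia.
case/connectP=> w; elim: w f fR fpZ fcZ {fpR hR} => [|r w IH] f fR fpZ fcZ /=.
  by move=> _ ->; exists f; rewrite connect0.
case/andP=> /and3P[fpD rD Yr] wP wl.
have rp : r != f p by rewrite eq_sym (adj_neq Yr).
pose D := R :\: (f p |: Z).
have lD : linked D by apply: sR; rewrite cardsU1 fpZ.
have fcD : f c \in D.
  by rewrite !inE (negPf fcZ) (inj_eq perm_inj) eq_sym (negPf pc) star_holds_blank.
have rD' : r \in D.
  by move: rD; rewrite !inE (negPf rp).
have [g [fg gc goff]] := slides_linked fR (subsetDl _ _) lD fcD rD'.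
have gp : g p = f p by apply: goff; rewrite !inE eqxx.
have gR := slides_holds fg fR.
have gV : (g^-1)%g (f p) = p by rewrite -gp permK.
have gg' : slide g (g * tperm r (f p))%g.
  by rewrite -gc; apply: slide_tperm; rewrite ?gV // gc adjC.
have g'R := slides_holds (connect1 gg') gR.
have rZ : r \notin Z by move: rD; rewrite inE => /andP[].
have g'p : (g * tperm r (f p))%g p = r by rewrite permM gp tpermR.
have g'c : (g * tperm r (f p))%g c = f p by rewrite permM gc tpermL.
have [||||k [g'k kp koff]] := IH _ g'R; rewrite ?g'p ?g'c //.
exists k; split=> //; first exact: connect_trans fg (connect_trans (connect1 gg') g'k).
move=> z fzZ; have zD : f z \notin D by rewrite !inE fzZ orbT.
have gz := goff z zD.
have fzr : f z != r by apply: contraNneq rZ => <-.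
have fzp : f z != f p by apply: contraNneq fpZ => <-.
have g'z : (g * tperm r (f p))%g z = f z by rewrite permM gz tpermD // eq_sym.
by rewrite koff g'z.
Qed.

Lemma slides_token3 R f p1 p2 p3 h1 h2 h3 e : star_holds R f -> sturdy R ->
  p1 \in S -> p2 \in S -> p3 \in S -> uniq [:: p1; p2; p3] ->
  h1 \in R -> h2 \in R -> h3 \in R -> e \in R -> uniq [:: e; h1; h2; h3] ->
  exists g, [/\ connect slide f g, g p1 = h1, g p2 = h2, g p3 = h3 & g c = e].
Proof.
move=> fR sR p1S p2S p3S; rewrite /= !inE !negb_or => /and3P[/andP[p12 p13] p23 _].
move=> h1R h2R h3R eR /and4P[/and3P[eh1 eh2 eh3] /andP[h12 h13] h23 _].
have pcN p : p \in S -> p != c by move=> pS; apply: contraNneq cS => <-.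
have [[p1c p2c] p3c] := (pcN _ p1S, pcN _ p2S, pcN _ p3S).
have fresh (Z : {set T}) : (#|Z| <= 8)%N -> exists2 k, k \in R & k \notin Z.
  move=> Z8; have : (0 < #|R :\: Z|)%N.
    rewrite cardsD subn_gt0; apply: leq_ltn_trans (subset_leq_card (subsetIr R Z)) _.
    exact: leq_ltn_trans Z8 sR.1.
  by case/card_gt0P=> k; rewrite inE => /andP[kZ kR]; exists k.
have card2 (a b : T) : (#|[set a; b]| <= 2)%N by rewrite cards2; case: (a != b).
have card_seq (s : seq T) : (#|[set z in s]| <= size s)%N by rewrite cardsE card_size.
have [k1 k1R k1Z] : exists2 k, k \in R & k \notin [set z in [:: f p1; f p2; f p3; h1; h2; h3]].
  by apply: fresh; apply: leq_trans (card_seq _) _.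
have [k2 k2R k2Z] : exists2 k, k \in R & k \notin [set z in [:: k1; f p1; f p2; f p3; h1; h2; h3]].
  by apply: fresh; apply: leq_trans (card_seq _) _.
have [k3 k3R k3Z] : exists2 k, k \in R & k \notin [set z in [:: k2; k1; f p1; f p2; f p3; h1; h2; h3]].
  by apply: fresh; apply: leq_trans (card_seq _) _.
move: k1Z k2Z k3Z; rewrite !inE !negb_or.
move=> /and5P[k1p1 k1p2 k1p3 k1h1 /andP[k1h2 k1h3]].
move=> /and5P[k21 k2p1 k2p2 k2p3 /and3P[k2h1 k2h2 k2h3]].
move=> /and5P[k32 k31 k3p1 k3p2 /and4P[k3p3 k3h1 k3h2 k3h3]].
have step g p p' p'' h : star_holds R g -> p \in S -> p != p' -> p != p'' -> p' != c -> p'' != c ->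
    h \in R -> h != g p' -> h != g p'' ->
    exists g', [/\ connect slide g g', star_holds R g', g' p = h, g' p' = g p' & g' p'' = g p''].
  move=> gR pS pq pr qc rc hR hq hr.
  have [|||g' [gg' g'p goff]] := @slides_token R g p [set g p'; g p''] h gR sR (card2 _ _) pS.
  - by rewrite !inE !(inj_eq perm_inj) negb_or pq.
  - by rewrite !inE !(inj_eq perm_inj) negb_or ![c == _]eq_sym qc.
  - by rewrite !inE negb_or hq hr.
  exists g'; split=> //; first exact: slides_holds gg' gR.
    by rewrite goff // !inE eqxx.
  by rewrite goff // !inE eqxx orbT.
(* The leaves first go to the fresh places k1, k2, k3: a leaf may not be sent
   directly to a target that another leaf still occupies. *)
have [g1 [c1 R1 g11 g12 g13]] : exists g1, [/\ connect slide f g1, star_holds R g1,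
    g1 p1 = k1, g1 p2 = f p2 & g1 p3 = f p3] by apply: step.
have [g2 [c2 R2 g22 g21 g23]] : exists g2, [/\ connect slide g1 g2, star_holds R g2,
    g2 p2 = k2, g2 p1 = k1 & g2 p3 = f p3].
  by rewrite -g11 -g13; apply: step; rewrite ?g11 ?g13 // eq_sym.
have [g3 [c3 R3 g33 g31 g32]] : exists g3, [/\ connect slide g2 g3, star_holds R g3,
    g3 p3 = k3, g3 p1 = k1 & g3 p2 = k2].
  by rewrite -g21 -g22; apply: step; rewrite ?g21 ?g22 // eq_sym.
have [g4 [c4 R4 g41 g42 g43]] : exists g4, [/\ connect slide g3 g4, star_holds R g4,
    g4 p1 = h1, g4 p2 = k2 & g4 p3 = k3].
  by rewrite -g32 -g33; apply: step; rewrite ?g32 ?g33 // eq_sym.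
have [g5 [c5 R5 g52 g51 g53]] : exists g5, [/\ connect slide g4 g5, star_holds R g5,
    g5 p2 = h2, g5 p1 = h1 & g5 p3 = k3].
  by rewrite -g41 -g43; apply: step; rewrite ?g41 ?g43 // eq_sym.
have [g6 [c6 R6 g63 g61 g62]] : exists g6, [/\ connect slide g5 g6, star_holds R g6,
    g6 p3 = h3, g6 p1 = h1 & g6 p2 = h2].
  by rewrite -g51 -g52; apply: step; rewrite ?g51 ?g52 // eq_sym.
pose D := R :\: [set z in [:: h1; h2; h3]].
have lD : linked D by apply: (proj2 sR); apply: leq_trans (card_seq _) _.
have g6cD : g6 c \in D.
  by rewrite !inE -g61 -g62 -g63 !(inj_eq perm_inj) ![c == _]eq_sym (negPf p1c) (negPf p2c) (negPf p3c) star_holds_blank.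
have eD : e \in D by rewrite !inE (negPf eh1) (negPf eh2) (negPf eh3) eR.
have [g7 [c7 g7c g7off]] := slides_linked R6 (subsetDl _ _) lD g6cD eD.
exists g7; split=> //; last 3 first.
- by rewrite g7off ?g61 // !inE eqxx.
- by rewrite g7off ?g62 // !inE eqxx orbT.
- by rewrite g7off ?g63 // !inE eqxx !orbT.
by do 5![apply: connect_trans; first eassumption]; apply: connect_trans c6 c7.
Qed.

Definition cyc3 (a b d : T) : {perm T} := (tperm a b * tperm a d)%g.

Lemma cyc3J q a b d : (q * cyc3 (q a) (q b) (q d))%g = (cyc3 a b d * q)%g.
Proof. by rewrite /cyc3 -!tpermJ -conjMg -conjgC. Qed.

(** If the supports of two permutations share a single point, then their
    commutator is a 3-cycle. *)
Lemma commg_cyc3 (u v : {perm T}) h : (forall z, u z != z -> v z != z -> z = h) ->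
  u h != h -> v h != h -> [~ u, v]%g = cyc3 h (v h) (u h).
Proof.
move=> uv uh vh.
have uN z : u z != z -> z != h -> v z = z.
  by move=> uz zh; apply/eqP; apply: contraNT zh => /(uv z uz)->.
have vN z : v z != z -> z != h -> u z = z.
  by move=> vz zh; apply/eqP; apply: contraNT zh => uz; apply/eqP/uv.
have moved (q : {perm T}) z : q z != z -> q (q z) != q z by rewrite (inj_eq perm_inj).
have movedV (q : {perm T}) z : q z != z -> q ((q^-1)%g z) != (q^-1)%g z.
  by rewrite permKV; apply: contraNneq => {1}->; rewrite permKV.
have fixV (q : {perm T}) z : q z = z -> (q^-1)%g z = z by move=> {1}<-; rewrite permK.
have vuh : v (u h) = u h by apply: uN => //; apply: moved.
have uvh : u (v h) = v h by apply: vN => //; apply: moved.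
have uvne : u h != v h.
  by apply: contraNneq uh => uvE; rewrite -(inj_eq (@perm_inj _ u)) {1}uvE uvh uvE.
apply/permP=> z; rewrite /commg conjgE !permM.
have [->|zh] := eqVneq z h.
  rewrite tpermL tpermD //; last by rewrite eq_sym.
  have VN : (u^-1)%g h != h by apply: contraNneq uh => {1}<-; rewrite permKV.
  by rewrite (fixV v) ?permKV // uN //; apply: movedV.
have [->|zvh] := eqVneq z (v h).
  by rewrite tpermR tpermL (fixV u) // permK vuh.
have [->|zuh] := eqVneq z (u h).
  rewrite [tperm h (v h) _]tpermD 1?eq_sym 1?[v h == _]eq_sym // tpermR permK.
  have VN : (v^-1)%g h != h by apply: contraNneq vh => {1}<-; rewrite permKV.
  by rewrite (vN _ (movedV _ _ vh) VN) permKV.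
rewrite !tpermD 1?eq_sym //.
have [uz|uz] := eqVneq (u z) z.
  rewrite (fixV u) //; have [vz|vz] := eqVneq (v z) z; first by rewrite (fixV v) // uz.
  rewrite (vN _ (movedV _ _ vz)) ?permKV //.
  by apply: contraNneq zvh => <-; rewrite permKV.
rewrite (fixV v); first by rewrite permKV uN.
apply: uN; first exact: movedV uz.
by apply: contraNneq zuh => <-; rewrite permKV.
Qed.

(** The alternating group is generated by the 3-cycles, in the form of an
    induction principle: multiplication by suitable 3-cycles makes the support
    smaller until at most a transposition is left, which parity excludes. *)
Lemma even_cyc3_ind (P : {perm T} -> Prop) : P 1%g ->
    (forall u v, P u -> P v -> P (u * v)%g) ->
    (forall a b d, a \in S -> b \in S -> d \in S -> uniq [:: a; b; d] -> P (cyc3 a b d)) ->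
  forall q, perm_on S q -> ~~ odd_perm q -> P q.
Proof.
move=> P1 PM P3 q; have [n] := ubnP #|[set z | q z != z]|.
elim: n q => // n IH q; rewrite ltnS => qn qS qe.
have [/eqP|/set0Pn[i]] := eqVneq [set z | q z != z] set0.
  move=> q0; suff -> : q = 1%g by [].
  apply/permP=> z; rewrite perm1; apply/eqP; apply: contraTT q0 => qz.
  by apply/set0Pn; exists z; rewrite inE.
rewrite inE => qi; pose j := q i.
have sup z : q z != z -> z \in S by apply: contraNT => zS; rewrite (out_perm qS).
have [k /and3P[qk ki kj]|no] := pickP [pred k | [&& q k != k, k != i & k != j]]; last first.
  (* support {i, j}: q is a transposition *)
  have qN z : z != i -> z != j -> q z = z.
    by move=> zi zj; have := no z; rewrite /= zi zj !andbT => /negbFE/eqP.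
  suff qE : q = tperm i j by move: qe; rewrite qE odd_tperm eq_sym qi.
  apply/permP=> z; case: tpermP => [->//|->|zi zj]; last by apply: qN; apply/eqP.
  have qj : q j != j by rewrite /j (inj_eq perm_inj).
  apply/eqP; apply: contraTT qj => qji; rewrite negbK; apply/eqP.
  have [//|qjj] := eqVneq (q j) j.
  by apply: (@perm_inj _ q); apply: qN.
have qj : q j != j by rewrite /j (inj_eq perm_inj).
have [iS jS kS] := And3 (sup i qi) (sup j qj) (sup k qk).
have ji : j != i by [].
have cycK : (cyc3 j i k * cyc3 j k i)%g = 1%g.
  by rewrite /cyc3 mulgA -(mulgA (tperm j i)) tperm2 mulg1 tperm2.
have qE : q = ((q * cyc3 j i k) * cyc3 j k i)%g by rewrite -mulgA cycK mulg1.
have jk : j != k by rewrite eq_sym.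
have uq : uniq [:: j; k; i] by rewrite /= !inE negb_or jk ji ki.
have cycE a b d z : a != z -> b != z -> d != z -> cyc3 a b d z = z.
  by move=> az bz dz; rewrite permM !tpermD.
have cycS : perm_on S (cyc3 j i k).
  apply/subsetP=> z; rewrite inE; apply: contraNT => zS.
  by rewrite cycE //; apply: contraNneq zS => <-.
rewrite qE; apply: (PM); last exact: P3.
apply: IH; first 1 last.
- exact: perm_onM.
- by rewrite odd_permM (negPf qe) odd_permM !odd_tperm ji jk.
apply: leq_trans qn; apply/proper_card/properP; split; last first.
  by exists i; rewrite inE // permM permM tpermL tpermD ?eqxx // eq_sym.
apply/subsetP=> z; rewrite !inE; apply: contraNneq => qz.
by rewrite permM qz cycE //; [apply: contraNneq qj | apply: contraNneq qi | apply: contraNneq qk] => ->; rewrite qz.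
Qed.

(** Otherwise deleting the neighbours of [h] would isolate [h]. *)
Lemma sturdy_degree R h : sturdy R -> h \in R -> (2 < #|[set r in R | adj Y h r]|)%N.
Proof.
case=> R9 sR hR; rewrite ltnNge; apply/negP=> N2; pose N := [set r in R | adj Y h r].
have hN : h \notin N by rewrite inE andbC; apply/negP=> /andP[/adj_neq]; rewrite eqxx.
have hD : h \in R :\: N by rewrite inE hN.
have [r rD] : exists r, r \in R :\: (h |: N).
  apply/card_gt0P; rewrite cardsD subn_gt0.
  apply: leq_ltn_trans (subset_leq_card (subsetIr _ _)) _.
  by rewrite cardsU1 hN add1n; apply: leq_ltn_trans R9; apply: leq_trans N2 _.
have rD' : r \in R :\: N by move: rD; rewrite !inE negb_or -andbA => /and3P[_ -> ->].
have /connectP[w] := sR N (leqW N2) _ _ hD rD'.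
case: w => [_ /= rh|r' w /= /andP[/and3P[_]]]; first by move: rD; rewrite -rh !inE eqxx.
by rewrite !inE => /andP[+ r'R] hr'; rewrite r'R hr'.
Qed.

(** All neighbours of an end [e] of a longest path lie on this path, and the
    edges from [e] to three of them, the first being the next vertex of the path,
    cut the path into two cycles that share only an edge [e h]. *)
Lemma chorded_cycle R : R != set0 ->
    {in R, forall h, (2 < #|[set r in R | adj Y h r]|)%N} ->
  exists e s1 h s2, [/\ s1 != [::], s2 != [::],
    uniq (e :: s1 ++ h :: s2), path (induced R) e (s1 ++ h :: s2)
    & induced R e h /\ induced R e (last h s2)].
Proof.
move=> /set0Pn[h0 h0R] deg.
pose P n := [exists w : n.-tuple T, if val w is e :: w' then
  [&& e \in R, uniq (e :: w') & path (induced R) e w'] else false].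
have exP : exists n, P n.
  by exists 1%N; apply/existsP; exists [tuple h0]; rewrite /= h0R.
have leP n : P n -> (n <= #|T|)%N.
  case/existsP=> -[[//|e w] /= /eqP <-] /and3P[_ us _]; have us' : uniq (e :: w) by [].
  by rewrite -[_.+1]/(size (e :: w)) -(card_uniqP us') max_card.
case: (ex_maxnP exP leP) => n /existsP[[[//|e w] /= sz]] /and3P[eR uw pw] nmax.
have nbr r : r \in R -> adj Y e r -> r \in w.
  move=> rR er; rewrite -[_ \in _]negbK; apply/negP=> rw.
  have : (n.+1 <= n)%N; last by rewrite ltnn.
  apply: nmax; apply/existsP.
  have sz' : size [:: r, e & w] == n.+1 by rewrite /= -(eqP sz).
  have re : induced R r e by rewrite /induced /= rR eR adjC er.
  exists (Tuple sz'); rewrite /= rR re pw /= !andbT.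
  by rewrite uw andbT inE negb_or rw andbT eq_sym (adj_neq er).
pose N := [set r in R | adj Y e r].
have NP r : r \in N -> [/\ induced R e r, r \in w & r != e].
  rewrite inE => /andP[rR er]; split; [by rewrite /induced /= eR rR | exact: nbr | by rewrite eq_sym (adj_neq er)].
have N3 : (2 < #|N|)%N by apply: deg.
case: w => [|a w] in uw pw nbr NP sz nmax *.
  by have /card_gt0P[r /NP[]] : (0 < #|N|)%N by apply: leq_trans N3.
have [b [d [bN dN ba da bd]]] : exists b d, [/\ b \in N, d \in N, b != a, d != a & b != d].
  have : (1 < #|N :\ a|)%N by have := cardsD1 a N; case: (a \in N) => /= E; move: N3; rewrite E ?add1n ?add0n // => /ltnW.
  case/card_gt1P=> b [d [+ + bd]]; rewrite !inE => /andP[ba bN] /andP[da dN].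
  by exists b, d; rewrite !inE.
have [[eb bw be] [ed dw de]] := (NP b bN, NP d dN).
have inw r : r != a -> r \in a :: w -> r \in w by rewrite inE => /negPf->.
move: (inw b ba bw) (inw d da dw) => {bw dw}bw dw.
wlog before : b d bN dN ba da bd eb bw be ed dw de / (index b w < index d w)%N.
  have [] := ltngtP (index b w) (index d w); first by move=> ? /(_ b d); apply.
    by move=> ? /(_ d b); apply=> //; rewrite eq_sym.
  by move=> /(index_inj _ bw) bdE; rewrite bdE ?eqxx in bd.
case/splitPr: bw uw pw dw before => w1 w2 uw pw dw before.
have {}dw : d \in w2.
  move: dw; rewrite mem_cat inE eq_sym (negPf bd) /= => /orP[dw1|//].
  move: before; rewrite !index_cat dw1.
  have -> : b \in w1 = false by apply/negP=> bw1; move: uw; rewrite /= cat_uniq /= bw1 !andbF.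
  by move/ltnW/(leq_trans (leq_addr _ _)); rewrite leqNgt index_mem dw1.
case/splitPr: dw uw pw {before nbr NP nmax sz} => w3 w4 uw pw.
exists e, (a :: w1), b, (rcons w3 d); rewrite last_rcons; split=> //.
- by case: (w3).
- have : uniq ((e :: (a :: w1) ++ b :: rcons w3 d) ++ w4).
    by rewrite /= -catA /= -cats1 -catA /=.
  by rewrite cat_uniq => /andP[].
- have : path (induced R) e (((a :: w1) ++ b :: rcons w3 d) ++ w4).
    by rewrite /= -catA /= -cats1 -catA /=.
  by rewrite cat_path => /andP[].
Qed.

(** With the blank at [e], turning it around one of the two cycles of
    [chorded_cycle] rotates the other persons on this cycle. The two rotations
    move a single person in common, so their commutator is a 3-cycle. *)
Lemma slides_cyc3_somewhere R : sturdy R -> exists e h1 h2 h3,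
  [/\ e \in R, h1 \in R, h2 \in R, h3 \in R & uniq [:: e; h1; h2; h3] /\
   forall f, star_holds R f -> f c = e -> connect slide f (f * cyc3 h1 h2 h3)%g].
Proof.
move=> sR; have R0 : R != set0.
  by rewrite -card_gt0; apply: leq_trans (proj1 sR).
have [|e [s1 [h [s2 [s1N s2N us ps [eh el]]]]]] := chorded_cycle R0.
  by move=> r rR; apply: sturdy_degree.
have inR r : r \in e :: s1 ++ h :: s2 -> r \in R.
  rewrite inE => /predU1P[->|]; first by case/and3P: eh.
  elim: (s1 ++ _) e ps {us eh el} => // a w IH e' /= /andP[/and3P[_ aR _] pw].
  by rewrite inE => /predU1P[->//|]; apply: IH pw.
pose u := walk_perm e (rcons (rcons s1 h) e); pose v := walk_perm e (rcons (h :: s2) e).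
have pu : path (induced R) e (rcons (rcons s1 h) e).
  rewrite rcons_path last_rcons.
  move: ps; rewrite -cat_rcons cat_path => /andP[-> _] /=.
  by rewrite induced_sym.
have pv : path (induced R) e (rcons (h :: s2) e).
  rewrite rcons_path /= eh.
  move: ps; rewrite cat_path => /andP[_ /= /andP[_ ->]] /=.
  by rewrite induced_sym.
have ue : u e = e by rewrite walk_perm_last last_rcons.
have ve : v e = e by rewrite walk_perm_last last_rcons.
have uE : u = (walk_perm e s1 * tperm (last e s1) h * tperm h e)%g.
  by rewrite /u !walk_perm_rcons last_rcons.
move: us; rewrite cons_uniq mem_cat cat_uniq inE !negb_or cons_uniq.
case/andP=> /and3P[es1 eh' es2] /and3P[us1 /andP[hs1 +] /andP[hs2 us2]].
rewrite -/(has (mem s1) s2) => hass.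
have vE : v = (tperm e h * walk_perm h s2 * tperm (last h s2) e)%g.
  by rewrite /v /= walk_perm_rcons mulgA.
have uout z : z \notin rcons s1 h -> u z = z.
  have [->//|ze zs] := eqVneq z e; apply: walk_perm_out.
  by rewrite inE negb_or ze mem_rcons inE negb_or ze zs.
have vout z : z \notin h :: s2 -> v z = z.
  have [->//|ze zs] := eqVneq z e; apply: walk_perm_out.
  by rewrite inE negb_or ze mem_rcons inE negb_or ze zs.
have uh : u h = last e s1.
  rewrite uE !permM (walk_perm_out (h := e)) ?tpermR ?inE ?negb_or 1?eq_sym ?eh' //.
  have lh : last e s1 \in s1 by case: (s1) s1N => //= a w _; exact: mem_last.
  by rewrite tpermD //; [apply: contraNneq hs1 | apply: contraNneq es1] => ->.
have vh : v h = last h s2.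
  rewrite vE !permM tpermR (walk_perm_out (h := h)) ?tpermR // inE negb_or eh'.
  exact: es2.
have uhs : u h \in s1 by rewrite uh; case: (s1) s1N => //= a w _; exact: mem_last.
have vhs : v h \in s2 by rewrite vh; case: (s2) s2N => //= a w _; exact: mem_last.
have uv z : u z != z -> v z != z -> z = h.
  move=> uz vz.
  have : z \in h :: s2 by apply: contraNT vz => /vout->.
  have : z \in rcons s1 h by apply: contraNT uz => /uout->.
  rewrite mem_rcons !inE => /predU1P[//|zs1] /predU1P[//|zs2].
  by case/negP: hass; apply/hasP; exists z.
have uhh : u h != h by apply: contraNneq hs1 => <-.
have vhh : v h != h by apply: contraNneq hs2 => <-.
have com := commg_cyc3 uv uhh vhh.
have uhv : u h != v h by apply: contra hass => /eqP uhv; apply/hasP; exists (u h); rewrite // uhv.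
exists e, h, (v h), (u h); split.
- by rewrite inR // mem_head.
- by rewrite inR // inE mem_cat mem_head !orbT.
- by rewrite inR // inE mem_cat inE vhs !orbT.
- by rewrite inR // inE mem_cat uhs !orbT.
split.
  rewrite /= !inE !negb_or eh' ![h == _]eq_sym vhh uhh [v h == u h]eq_sym uhv !andbT /=.
  by apply/andP; split; [apply: contraNneq es2 | apply: contraNneq es1] => ->.
move=> f fR fe.
have turn q g : q = u \/ q = v -> star_holds R g -> g c = e ->
    [/\ connect slide g (g * q)%g, star_holds R (g * q)%g & (g * q)%g c = e].
  move=> quv gR ge; have gq : connect slide g (g * q)%g.
    by case: quv => ->; rewrite /u /v -ge; apply: slides_walk gR _; rewrite ge.
  split=> //; first exact: slides_holds gq gR.
  by rewrite permM ge; case: quv => ->.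
have turnV q g : q = u \/ q = v -> star_holds R g -> g c = e ->
    [/\ connect slide g (g * q^-1)%g, star_holds R (g * q^-1)%g & (g * q^-1)%g c = e].
  move=> quv gR ge; have qe : (q^-1)%g e = e by apply/eqP; rewrite -(inj_eq (@perm_inj _ q)) permKV; case: quv => ->; rewrite ?ue ?ve.
  have qR : perm_on R q.
    apply/subsetP=> z; rewrite inE; apply: contraNT => zR.
    apply/eqP; case: quv => ->; [apply: uout | apply: vout]; apply: contra zR => zs; apply: inR.
      by rewrite inE -cat_rcons mem_cat zs orbT.
    by rewrite inE mem_cat zs !orbT.
  have gqR : star_holds R (g * q^-1)%g.
    by move=> z; rewrite permM perm_closed ?perm_onV // gR.
  have gqc : (g * q^-1)%g c = e by rewrite permM ge.
  have [gq _ _] := turn q _ quv gqR gqc.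
  by split=> //; rewrite slides_sym -{2}[g]mulg1 -(mulVg q) mulgA.
rewrite -com; clearbody u v; rewrite /commg conjgE !mulgA.
have [c1 R1 e1] := turnV u f (or_introl erefl) fR fe.
have [c2 R2 e2] := turnV v _ (or_intror erefl) R1 e1.
have [c3 R3 e3] := turn u _ (or_introl erefl) R2 e2.
have [c4 R4 e4] := turn v _ (or_intror erefl) R3 e3.
exact: connect_trans (connect_trans c1 c2) (connect_trans c3 c4).
Qed.

(** Conjugation: carry the three leaves to the place where a 3-cycle is
    available, apply it, and carry them back by the reversed moves. *)
Lemma slides_cyc3 R f a b d : sturdy R -> star_holds R f ->
  a \in S -> b \in S -> d \in S -> uniq [:: a; b; d] ->
  connect slide f (cyc3 a b d * f)%g.
Proof.
move=> sR fR aS bS dS uabd.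
have [e [h1 [h2 [h3 [eR h1R h2R h3R [uh turn]]]]]] := slides_cyc3_somewhere sR.
have [g [fg ga gb gd gc]] := slides_token3 fR sR aS bS dS uabd h1R h2R h3R eR uh.
have := turn g (slides_holds fg fR) gc; rewrite -ga -gb -gd cyc3J => gg'.
apply: (connect_trans fg) (connect_trans gg' _); rewrite slides_sym.
apply: slides_mul fg; apply/subsetP=> z; rewrite inE; apply: contraNT => zS.
by rewrite permM !tpermD //; apply: contraNneq zS => <-.
Qed.

Definition odd_closed (R : {set T}) := {in R, forall h, exists w,
  [/\ path (induced R) h w, last h w = h & odd (size w)]}.

(** Even permutations of the leaves are products of 3-cycles, and sending the
    blank around an odd closed walk gives an odd one. *)
Lemma slides_perm R f q : sturdy R -> odd_closed R -> star_holds R f ->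
  perm_on S q -> connect slide f (q * f)%g.
Proof.
move=> sR oR fR qS.
have even k : perm_on S k -> ~~ odd_perm k -> connect slide f (k * f)%g.
  move=> kS kE; pose P u := perm_on S u /\ connect slide f (u * f)%g.
  suff [] : P k by [].
  apply: even_cyc3_ind => //; rewrite /P ?mul1g ?perm_on1 ?connect0 //.
    move=> u v [uS fu] [vS fv]; split; first exact: perm_onM.
    by apply: connect_trans fu _; rewrite -mulgA; apply: slides_mul.
  move=> a b d aS bS dS uabd; split; last exact: (slides_cyc3 sR fR).
  apply/subsetP=> z; rewrite inE; apply: contraNT => zS.
  by rewrite permM !tpermD //; apply: contraNneq zS => <-.
have [qo|] := boolP (odd_perm q); last exact: even.
have [w [pw lw ow]] := oR _ (star_holds_blank fR).
have fg := slides_walk fR pw; set g := (f * _)%g in fg.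
pose k := (g * f^-1)%g; have gE : g = (k * f)%g by rewrite /k mulgKV.
have gc : g c = f c by rewrite permM walk_perm_last.
have kS : perm_on S k.
  apply/subsetP=> z; rewrite inE; apply: contraNT => zS.
  have [->|zc] := eqVneq z c; first by rewrite permM gc permK.
  by rewrite permM (slides_off fg) ?permK // !inE negb_or zc.
have ko : odd_perm k.
  by rewrite /k odd_permM odd_permV odd_permM (walk_perm_odd pw) ow addbC addbA addbb.
apply: connect_trans fg _; rewrite gE slides_sym.
have -> : (k * f)%g = (q * ((q^-1 * k) * f))%g by rewrite !mulgA mulgV mul1g.
apply: slides_mul => //; apply: even; first by rewrite perm_onM // perm_onV.
by rewrite odd_permM odd_permV qo ko.
Qed.

Lemma slides_all R f g : sturdy R -> odd_closed R -> star_holds R f ->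
  star_holds R g -> (forall z, z \notin c |: S -> f z = g z) -> connect slide f g.
Proof.
move=> sR oR fR gR offE.
have RD : R :\: set0 = R by rewrite setD0.
have lR : linked R by rewrite -RD; apply: (proj2 sR); rewrite cards0.
have [g' [gg' g'c _]] := slides_linked gR (subxx _) lR (star_holds_blank gR) (star_holds_blank fR).
rewrite slides_sym; apply: (connect_trans gg'); rewrite slides_sym.
rewrite -(mulgKV f g'); apply: slides_perm sR oR fR _.
apply/subsetP=> z; rewrite inE; apply: contraNT => zS.
have [->|zc] := eqVneq z c; first by rewrite permM g'c permK.
have zcS : z \notin c |: S by rewrite !inE negb_or zc.
by rewrite permM (slides_off gg') // -offE // permK.
Qed.
End Wilson.

(** * Exchanging two persons *)

Section Exchange.
Variables (c : T) (S P : {set T}) (f : {perm T}).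
Hypotheses (cS : c \notin S) (XS : forall z, z \in S -> adj X c z).
Let V := f @: P.
Hypothesis Vgood : forall s t, s \in V -> t \in V -> s != t ->
  sturdy (V :\: [set s; t]) /\ odd_closed (V :\: [set s; t]).

Lemma imsetV z : (f z \in V) = (z \in P).
Proof. by rewrite mem_imset //; exact: perm_inj. Qed.

(** The persons [s] and [t] stand at the two posts [x] and [y], which lie off the
    star, and the placement agrees with [f] outside of the positions [P] in play. *)
Definition posted x y s t g :=
  [/\ g x = s, g y = t & forall z, z \notin P -> g z = f z].

Lemma posted_in g : (forall z, z \notin P -> g z = f z) -> forall z, (g z \in V) = (z \in P).
Proof.
move=> gf z; have [zP|zP] := boolP (z \in P); last by rewrite gf // imsetV (negPf zP).
apply: contraTT zP => gV; pose a := (f^-1)%g (g z).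
have fa : f a = g z by rewrite permKV.
have aP : a \notin P by rewrite -imsetV fa.
have <- // : a = z by apply: (@perm_inj _ g); rewrite gf.
Qed.

Section Post.
Variables (x y b : T).
Hypothesis PE : forall z, (z \in P) = [|| z == x, z == y | z \in c |: S].
Hypotheses (xy : x != y) (xS : x \notin c |: S) (yS : y \notin c |: S).
Hypotheses (bS : b \in S) (Xxb : adj X x b).

Lemma posted_holds s t g : posted x y s t g -> star_holds c S (V :\: [set s; t]) g.
Proof.
case=> gx gy gf z; rewrite inE posted_in // PE !inE -gx -gy !(inj_eq perm_inj).
have [->|zx] := eqVneq z x; first by move: xS; rewrite !inE => /negPf->.
by have [->|zy] := eqVneq z y; first by move: yS; rewrite !inE => /negPf->.
Qed.

Lemma posted_distinct s t g : posted x y s t g -> [/\ s \in V, t \in V & s != t].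
Proof.
case=> <- <- gf; rewrite !posted_in // !PE !eqxx !orbT (inj_eq perm_inj); by split.
Qed.

(** The posts being occupied by given persons, all arrangements of the others on
    the star are connected with each other by the sliding puzzle. *)
Lemma posted_connect s t g g' :
  posted x y s t g -> posted x y s t g' -> connect (FS X Y) g g'.
Proof.
move=> pg pg'; have [sV tV st] := posted_distinct pg.
have [sVst oVst] := Vgood sV tV st.
apply: (slides_FS (c := c) (S := S)) => //.
apply: slides_all sVst oVst (posted_holds pg) (posted_holds pg') _ => // z zS.
have [gx gy gf] := pg; have [g'x g'y g'f] := pg'.
have [->|zx] := eqVneq z x; first by rewrite gx.
have [->|zy] := eqVneq z y; first by rewrite gy.
by rewrite gf ?g'f // PE negb_or zx negb_or zy.
Qed.

(** A friend [s'] of [s] relieves [s] at the post [x]: by [posted_connect] it may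
    be assumed that [s'] stands on the leaf [b] next to [x]. *)
Lemma posted_step s s' t g : posted x y s t g -> s' \in V -> s' != t ->
  adj Y s s' -> exists2 g', posted x y s' t g' & connect (FS X Y) g g'.
Proof.
move=> pg s'V s't Yss'; have [gx gy gf] := pg.
have s's := adj_neq Yss'.
have bP : b \in P by rewrite PE !inE bS !orbT.
have bx : b != x by apply: contraNneq xS => <-; rewrite !inE bS orbT.
have by' : b != y by apply: contraNneq yS => <-; rewrite !inE bS orbT.
pose k := (g * tperm (g b) s')%g.
have pk : posted x y s t k.
  split=> [||z zP]; rewrite /k permM.
  - by rewrite gx tpermD //; [rewrite -gx (inj_eq perm_inj) | rewrite eq_sym].
  - by rewrite gy tpermD // -gy (inj_eq perm_inj).
  rewrite (gf z zP) tpermD //; apply: contraNneq zP => fzb; rewrite -imsetV -fzb //.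
  by rewrite posted_in.
have kb : k b = s' by rewrite permM tpermL.
have kx : k x = s by case: pk.
exists (k * tperm (k x) (k b))%g; last first.
  apply: connect_trans (posted_connect pg pk) _; apply/connect1/FS_swap => //.
  by rewrite kx kb.
have [_ ky kf] := pk; have [sV _ st] := posted_distinct pk.
split=> [||z zP]; rewrite permM ?tpermL // kx kb ?ky ?kf // tpermD //.
- by apply: contraNneq zP => fzb; rewrite -imsetV -fzb.
- by apply: contraNneq zP => fzb; rewrite -imsetV -fzb.
Qed.

Lemma posted_walk s s' t g : posted x y s t g -> s' != t -> s' \in V ->
  linked (V :\ t) -> exists2 g', posted x y s' t g' & connect (FS X Y) g g'.
Proof.
move=> pg s't s'V lV; have [sV tV st] := posted_distinct pg.
have /connectP[w] : connect (induced (V :\ t)) s s' by apply: lV; rewrite !inE ?st ?s't.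
elim: w s g pg {sV st} => [|r w IH] s g pg /=; first by move=> _ ->; exists g; rewrite ?connect0.
case/andP=> /and3P[_ + Ysr] pw lw; rewrite !inE => /andP[rt rV].
have [g1 pg1 gg1] := posted_step pg rV rt Ysr.
have [g2 pg2 g12] := IH _ _ pg1 pw lw.
by exists g2 => //; apply: connect_trans gg1 g12.
Qed.
End Post.

Lemma posted_swap x y s t g : posted x y s t g <-> posted y x t s g.
Proof. by split; case. Qed.

(** The persons at the posts walk on the graph [Y], as two tokens that must not
    meet. With the help of a third place [f c] the tokens trade places:
    [(f x, f y)], [(f c, f y)], [(f c, f x)], [(f y, f x)]. *)
Lemma FS_exchange x y b b' :
  (forall z, (z \in P) = [|| z == x, z == y | z \in c |: S]) ->
  x != y -> x \notin c |: S -> y \notin c |: S ->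
  b \in S -> adj X x b -> b' \in S -> adj X y b' ->
  (forall t, t \in V -> linked (V :\ t)) ->
  connect (FS X Y) f (tperm x y * f)%g.
Proof.
move=> PE xy xS yS bS Xb b'S Xb' lV.
have PE' z : (z \in P) = [|| z == y, z == x | z \in c |: S] by rewrite PE orbCA.
have yx : y != x by rewrite eq_sym.
have p0 : posted x y (f x) (f y) f by [].
have cP : c \in P by rewrite PE !inE eqxx !orbT.
have xP : x \in P by rewrite PE eqxx.
have yP : y \in P by rewrite PE eqxx orbT.
have fcV : f c \in V by rewrite imsetV.
have fxV : f x \in V by rewrite imsetV.
have fyV : f y \in V by rewrite imsetV.
have xc : f c != f x by rewrite (inj_eq perm_inj); apply: contraNneq xS => <-; rewrite setU11.
have yc : f c != f y by rewrite (inj_eq perm_inj); apply: contraNneq yS => <-; rewrite setU11.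
have fxy : f x != f y by rewrite (inj_eq perm_inj).
have [g1 p1 c1] := posted_walk PE xy xS yS bS Xb p0 yc fcV (lV _ fyV).
have xc' : f x != f c by rewrite eq_sym.
have [g2 p2 c2] := posted_walk PE' yx yS xS b'S Xb' (proj1 (posted_swap _ _ _ _ _) p1) xc' fxV (lV _ fcV).
have fyx : f y != f x by rewrite eq_sym.
have [g3 p3 c3] := posted_walk PE xy xS yS bS Xb (proj1 (posted_swap _ _ _ _ _) p2) fyx fyV (lV _ fxV).
have p4 : posted x y (f y) (f x) (tperm x y * f)%g.
  split=> [||z zP]; rewrite permM ?tpermL ?tpermR // tpermD //.
    by apply: contraNneq zP => <-.
  by apply: contraNneq zP => <-.
have c4 := posted_connect PE xy xS yS p3 p4.
exact: connect_trans (connect_trans c1 c2) (connect_trans c3 c4).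
Qed.
End Exchange.

Lemma FS_connected_exchange :
  (forall f x y, x != y -> connect (FS X Y) f (tperm x y * f)%g) -> FS_connected X Y.
Proof.
move=> ex; apply/forallP=> f; apply/forallP=> g.
have [ts gf ats] := prod_tpermP (g * f^-1)%g.
rewrite -(mulgKV f g) gf; elim: ts ats {gf} => [|[x y] ts IH] /=.
  by rewrite big_nil mul1g connect0.
case/andP=> xy /IH fts; rewrite big_cons -mulgA.
exact: connect_trans fts (ex _ _ _ xy).
Qed.
End StarPuzzle.

(** * Robust sets of persons *)

Section Robust.
Variables (T : finType) (X Y : sgraph T).
Implicit Types (f : {perm T}) (A B Z S V N : {set T}).

Definition no_edge A B := [forall a in A, forall b in B, ~~ adj Y a b].

Lemma no_edgePn A B :
  reflect (exists a b, [/\ a \in A, b \in B & adj Y a b]) (~~ no_edge A B).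
Proof.
apply: (iffP idP) => [|[a [b [aA bB ab]]]].
  case/forallPn=> a; rewrite negb_imply => /andP[aA /forallPn[b]].
  by rewrite negb_imply negbK => /andP[bB ab]; exists a, b.
by apply/negP=> /forall_inP/(_ a aA)/forall_inP/(_ b bB); rewrite ab.
Qed.

(** This is the form in which connectivity is needed and in which it admits a
    union bound: no set of moderate size is cut off from [S], even after the
    deletion of five vertices. The set [A] need not lie in [S], so the property
    also provides every single vertex with many neighbours in [S]. *)
Definition expanding S := [forall Z : {set T}, forall A : {set T},
  [&& #|Z| <= 5, A != set0 & 3 * #|A| <= 2 * #|S|]%N ==>
  ~~ no_edge A (S :\: (Z :|: A))].

(** A quantitative form of being non-bipartite. *)
Definition entangled S := [forall A : {set T},
  (A \subset S) && (#|S| <= 4 * #|A|)%N ==> ~~ no_edge A A].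

Definition robust S := [&& (24 <= #|S|)%N, expanding S & entangled S].

(** If [V] minus [Z] were disconnected, then a union of components or its
    complement would have at most two thirds of the size of [S]. The three
    vertices of [V] outside of [S] will be the persons at [c], [x] and [y]; the
    five deleted ones make up for the persons at the posts and for the three
    deletions in [sturdy]. *)
Lemma robust_linked S V Z : robust S -> S \subset V -> (#|V| <= #|S| + 3)%N ->
  (#|Z| <= 5)%N -> linked Y (V :\: Z).
Proof.
case/and3P=> S24 /forallP exS _ SV VS Z5 a b aD bD; set D := V :\: Z in aD bD *.
have ex A : A != set0 -> (3 * #|A| <= 2 * #|S|)%N -> A \subset D ->
    exists a b, [/\ a \in A, b \in D :\: A & adj Y a b].
  move=> A0 A3 AD; have /forallP/(_ A) := exS Z; rewrite Z5 A0 A3 => /no_edgePn.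
  case=> a' [b' [a'A b'S ab']]; exists a', b'; split=> //.
  by move: b'S; rewrite !inE negb_or -andbA => /and3P[-> -> /(subsetP SV)->].
apply/negPn/negP=> nab; pose A := [set z in D | connect (induced Y D) a z].
have inA z : (z \in A) = (z \in D) && connect (induced Y D) a z by rewrite inE.
have aA : a \in A by rewrite inA aD connect0.
have bA : b \in D :\: A by rewrite in_setD inA (negPf nab) andbF bD.
have sAD : A \subset D by apply/subsetP=> z; rewrite inA => /andP[].
have closedA u v : u \in A -> v \in D :\: A -> adj Y u v -> False.
  rewrite in_setD !inA => /andP[uD au] /andP[+ vD] uv; rewrite vD /= => /negP[].
  apply: connect_trans au (connect1 _); by rewrite /induced /= uD vD.
have [A3|A3] := leqP (3 * #|A|) (2 * #|S|).
  have [|u [v [uA vA uv]]] := ex A _ A3 sAD; last exact: closedA uA vA uv.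
  by apply/set0Pn; exists a.
have [||u [v [uA vA uv]]] := ex (D :\: A) _ _ (subsetDl _ _).
- by apply/set0Pn; exists b.
- have DV := subset_leq_card (subsetDl V Z).
  have := cardsID A D; rewrite (setIidPr sAD).
  move: (#|D :\: A|)%N (#|D|)%N (#|A|)%N (#|S|)%N (#|V|)%N A3 S24 VS DV; clear; lia.
- apply: (closedA v u); rewrite 1?adjC //.
  by move: vA; rewrite setDDr setDv set0U => /setIP[].
Qed.

(** In the bipartite double cover, without an odd closed walk at [h] the vertices
    would split into two independent classes, one of which contains at least a
    quarter of [S]. *)
Lemma entangled_odd_closed S V s t : robust S -> S \subset V ->
  (#|V| <= #|S| + 3)%N -> odd_closed Y (V :\: [set s; t]).
Proof.
move=> rS SV VS; set D := V :\: _.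
have lD : linked Y D by apply: robust_linked SV VS _ => //; rewrite cards2; case: (s != t).
move=> h hD.
pose e2 : rel (T * bool) := fun u v => induced Y D u.1 v.1 && (v.2 == ~~ u.2).
have e2_sym : symmetric e2.
  by move=> [a i] [b j]; rewrite /e2 /= induced_sym; case: i; case: j.
have e2C : connect_sym e2 by apply: sym_connect_sym.
have project w u : path e2 u w ->
    path (induced Y D) u.1 (map fst w) /\ (last u w).2 = u.2 (+) odd (size w).
  elim: w u => [|v w IH] u /=; first by rewrite addbF.
  case/andP=> /andP[-> /eqP v2] /IH[-> ->]; split=> //.
  by rewrite v2; case: (u.2); case: (odd _).
have lift w a i : path (induced Y D) a w -> exists j, connect e2 (a, i) (last a w, j).
  elim: w a i => [|b w IH] a i /=; first by exists i; rewrite connect0.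
  case/andP=> ab /(IH _ (~~ i))[j bj]; exists j; apply: connect_trans bj.
  by apply: connect1; rewrite /e2 /= ab eqxx.
have flip a i b j : connect e2 (a, i) (b, j) -> connect e2 (a, ~~ i) (b, ~~ j).
  case/connectP=> w; elim: w a i => [|[d k] w IH] a i /=.
    by move=> _ [-> ->]; rewrite connect0.
  case/andP=> /andP[/= ad /eqP ki] pw lw; apply: connect_trans (IH _ _ pw lw).
  by apply: connect1; rewrite /e2 /= ad ki eqxx.
suff odd_walk : connect e2 (h, false) (h, true).
  have /connectP[w pw lw] := odd_walk; have [pw1 lw2] := project _ _ pw.
  exists (map fst w); split; rewrite ?size_map //.
    by rewrite (last_map fst w (h, false)) -lw.
  by move: lw2; rewrite -lw /= => <-.
pose C i := [set z in S :&: D | connect e2 (h, false) (z, i)].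
have [i Ci] : exists i, (#|S| <= 4 * #|C i|)%N.
  have SC : S :\: [set s; t] \subset C false :|: C true.
    apply/subsetP=> z zS; have zD : z \in D by apply: subsetP zS; apply: setSD.
    have [j hj] : exists j, connect e2 (h, false) (z, j).
      by have /connectP[w pw ->] := lD _ _ hD zD; apply: lift.
    have zS' : z \in S by move: zS; rewrite inE => /andP[].
    have zSD : z \in S :&: D by rewrite in_setI zS'.
    by apply/setUP; case: j hj; [right | left]; rewrite inE zSD.
  have S24 : (24 <= #|S|)%N by case/and3P: rS.
  have cST : (#|S| <= #|S :\: [set s; t]| + 2)%N.
    rewrite -(cardsID [set s; t] S) addnC leq_add2l.
    by apply: leq_trans (subset_leq_card (subsetIr _ _)) _; rewrite cards2; case: (s != t).
  have := leq_trans (subset_leq_card SC) (leq_card_setU _ _).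
  have [C0|C0] := leqP #|S| (4 * #|C false|)%N; first by exists false.
  by move=> CC; exists true; move: S24 cST CC C0; clear; lia.
have /and3P[_ _ /forallP/(_ (C i))] := rS.
rewrite Ci andbT; have -> : C i \subset S.
  by apply/subsetP=> z; rewrite inE => /andP[/setIP[]].
case/no_edgePn=> a [b []]; rewrite inE => /andP[/setIP[aS aD] ha].
rewrite inE => /andP[/setIP[bS bD] hb] ab.
have hb' : connect e2 (h, false) (b, ~~ i).
  by apply: connect_trans ha (connect1 _); rewrite /e2 /induced /= aD bD ab eqxx.
apply: connect_trans hb' _; rewrite e2C; exact: flip hb.
Qed.

(** The deterministic criterion: the star around [c] with leaves [N] serves to
    exchange the persons at [x] and [y]. *)
Lemma FS_exchange_trial f x y c N b b' : x != y -> c != x -> c != y ->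
  (forall z, z \in N -> z != c -> adj X c z) -> robust (f @: N) ->
  b \in N :\: [set c; x; y] -> adj X x b ->
  b' \in N :\: [set c; x; y] -> adj X y b' ->
  connect (FS X Y) f (tperm x y * f)%g.
Proof.
move=> xy cx cy XN rN bN Xb b'N Xb'.
pose S := N :\: [set c; x; y]; pose P := N :|: [set c; x; y].
have sNP : f @: N \subset f @: P by apply/imsetS/subsetUl.
have cP : (#|f @: P| <= #|f @: N| + 3)%N.
  rewrite !card_imset //; try exact: perm_inj.
  apply: leq_trans (leq_card_setU _ _) _; rewrite leq_add2l.
  by rewrite -setUA !cardsU1 cards1; case: (_ \notin _); case: (_ \notin _).
have cS : c \notin S by rewrite !inE eqxx.
have lP Z : (#|Z| <= 5)%N -> linked Y (f @: P :\: Z) by apply: robust_linked rN sNP cP.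
have card2 (s t : T) : (#|[set s; t]| <= 2)%N by rewrite cards2; case: (s != t).
have N24 : (24 <= #|f @: N|)%N by case/and3P: rN.
apply: (@FS_exchange _ X Y c S P f cS _ _ x y b b') => //.
- by move=> z; rewrite !inE !negb_or -!andbA => /and4P[zc _ _ zN]; apply: XN.
- move=> s t _ _ st; split; last exact: entangled_odd_closed rN sNP cP.
  split=> [|Z Z3].
    rewrite cardsD ltn_subRL; apply: leq_ltn_trans (leq_add (subset_leq_card (subsetIr _ _)) (leqnn _)) _.
    apply: leq_ltn_trans (leq_add (card2 s t) (leqnn _)) _.
    exact: leq_trans (leq_trans _ N24) (subset_leq_card sNP).
  rewrite setDDl; apply: lP; apply: leq_trans (leq_card_setU _ _) _.
  exact: leq_add (card2 s t) Z3.
- move=> z; rewrite !inE; case: (z == c); case: (z == x); case: (z == y); rewrite ?orbT ?andbT ?orbF //.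
- by rewrite !inE eqxx !orbT /= orbF eq_sym.
- by rewrite !inE eqxx !orbT /= orbF eq_sym.
- by move=> t _; apply: lP; rewrite cards1.
Qed.
End Robust.

Local Open Scope ring_scope.

(** * Random graphs, random sets and random digraphs *)

Section RandomGraph.
Variables (R : realType) (n : nat).
Implicit Types (p q : R) (G X Y : sgraph 'I_n) (A B S : {set 'I_n}).

(** The generating identity from which the distribution of a random graph is
    read off: the edges are independent. *)
Lemma sum_graph_prod (F H : {set 'I_n} -> R) :
  \sum_(G : sgraph 'I_n) \prod_(e in pairs 'I_n) (if e \in edges G then F e else H e)
  = \prod_(e in pairs 'I_n) (F e + H e).
Proof.
pose F' e := if e \in pairs 'I_n then F e else 0.
pose H' e := if e \in pairs 'I_n then H e else 1.
transitivity (\prod_(e : {set 'I_n}) (F' e + H' e)); last first.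
  rewrite [RHS]big_mkcond /=; apply: eq_bigr => e _; rewrite /F' /H'.
  by case: ifP => _; rewrite ?add0r.
rewrite bigA_distr (bigID (fun E : {set {set 'I_n}} => E \subset pairs 'I_n)) /=.
rewrite [X in _ = _ + X]big1 ?addr0; last first.
  move=> E /subsetPn[e eE eP].
  by rewrite (bigD1 e) //= eE /F' (negPf eP) mul0r.
rewrite [RHS](reindex_omap (@edges 'I_n) insub) /=; last first.
  by move=> E sE; rewrite insubT.
apply: eq_big => [G|G _]; first by rewrite (valK G) eqxx andbT edges_pairs.
rewrite big_mkcond; apply: eq_bigr => e _; rewrite /F' /H'.
case: (boolP (e \in pairs _)) => // eP.
by case: ifP => // /(subsetP (edges_pairs G)); rewrite (negPf eP).
Qed.

Lemma gnp_ge0 p G : 0 <= p <= 1 -> 0 <= gnp p G.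
Proof.
by case/andP=> p0 p1; apply: prodr_ge0 => e _; case: ifP => _; rewrite ?subr_ge0.
Qed.

Lemma gnp_avoid p (E : {set {set 'I_n}}) : E \subset pairs 'I_n ->
  \sum_(G : sgraph 'I_n | [disjoint edges G & E]) gnp p G = (1 - p) ^+ #|E|.
Proof.
move=> sE; transitivity (\sum_(G : sgraph 'I_n) \prod_(e in pairs 'I_n)
    (if e \in edges G then (if e \in E then 0 else p) else 1 - p)).
  rewrite big_mkcond; apply: eq_bigr => G _; rewrite /gnp.
  case: ifPn => [dGE|/pred0Pn[e /= /andP[eG eE]]].
    apply: eq_bigr => e _; case: ifP => // eG.
    by rewrite (disjointFr dGE eG).
  by rewrite (bigD1 e) /= ?(subsetP sE) // eG eE mul0r.
rewrite sum_graph_prod (bigID [in E]) /= [X in _ * X]big1 ?mulr1; last first.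
  by move=> e /andP[_ /negPf->]; rewrite subrKC.
rewrite (eq_bigl [in E]) => [|e]; last first.
  by rewrite andb_idl // => /(subsetP sE).
by rewrite -prodr_const; apply: eq_bigr => e ->; rewrite add0r.
Qed.

Lemma sum_pred_le (T : finType) (P Q : pred T) (w : T -> R) :
  (forall t, 0 <= w t) -> (forall t, P t -> Q t) ->
  \sum_(t | P t) w t <= \sum_(t | Q t) w t.
Proof.
move=> w0 PQ; rewrite [leLHS]big_mkcond [leRHS]big_mkcond; apply: ler_sum => t _.
by case: ifP => [/PQ->//|_]; case: ifP.
Qed.

Lemma sum_or_le (T : finType) (P Q : pred T) (w : T -> R) :
  (forall t, 0 <= w t) ->
  \sum_(t | P t || Q t) w t <= \sum_(t | P t) w t + \sum_(t | Q t) w t.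
Proof.
move=> w0; rewrite [leLHS]big_mkcond [X in _ <= X + _]big_mkcond [X in _ <= _ + X]big_mkcond.
rewrite -big_split; apply: ler_sum => t _ /=.
by case: (P t); case: (Q t); rewrite /= ?addr0 ?add0r // lerDl.
Qed.

Lemma sum_exists_le (T I : finType) (D : pred I) (P : I -> pred T) (w : T -> R) :
  (forall t, 0 <= w t) ->
  \sum_(t | [exists i, D i && P i t]) w t <= \sum_(i | D i) \sum_(t | P i t) w t.
Proof.
move=> w0; under [leRHS]eq_bigr do rewrite big_mkcond.
rewrite exchange_big /= [leLHS]big_mkcond; apply: ler_sum => t _.
case: ifP => [/existsP[i /andP[Di Pi]]|_]; last first.
  by apply: sumr_ge0 => i _; case: ifP.
rewrite (bigD1 i) //= Pi lerDl; apply: sumr_ge0 => j _; by case: ifP.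
Qed.

Lemma gnp_no_edge_le p A B : 0 <= p <= 1 -> [disjoint A & B] ->
  \sum_(Y : sgraph 'I_n | no_edge Y A B) gnp p Y <= (1 - p) ^+ (#|A| * #|B|).
Proof.
move=> p01 dAB; pose E := [set [set a; b] | a in A, b in B].
have neq a b : a \in A -> b \in B -> a != b.
  by move=> aA; apply: contraTneq => <-; rewrite (disjointFr dAB aA).
have sE : E \subset pairs 'I_n.
  by apply/subsetP=> _ /imset2P[a b aA bB ->]; rewrite inE cards2 neq.
have cE : #|E| = (#|A| * #|B|)%N.
  rewrite /E curry_imset2X card_in_imset ?cardsX // => -[a b] [a' b'].
  rewrite !inE /= => /andP[aA bB] /andP[a'A b'B] /setP eq2.
  have := eq2 a; rewrite !inE eqxx (negPf (neq _ _ aA b'B)) orbF => /esym/eqP aa'.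
  have := eq2 b; rewrite !inE eqxx orbT eq_sym (negPf (neq _ _ a'A bB)) => /esym/eqP bb'.
  by rewrite aa' bb'.
rewrite -cE -(gnp_avoid _ sE); apply: sum_pred_le => [Y|Y nAB]; first exact: gnp_ge0.
apply/pred0P=> e /=; apply/negP=> /andP[eY /imset2P[a b aA bB eE]].
by move: nAB => /forall_inP/(_ a aA)/forall_inP/(_ b bB); rewrite /adj -eE eY.
Qed.

Lemma gnp_no_edge_inside_le p A : 0 <= p <= 1 ->
  \sum_(Y : sgraph 'I_n | no_edge Y A A) gnp p Y <= (1 - p) ^+ 'C(#|A|, 2).
Proof.
move=> p01; pose E := [set e : {set 'I_n} | e \subset A & #|e| == 2].
have sE : E \subset pairs 'I_n by apply/subsetP=> e; rewrite !inE => /andP[].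
rewrite -cards_draws -(gnp_avoid _ sE); apply: sum_pred_le => [Y|Y nAA]; first exact: gnp_ge0.
apply/pred0P=> e /=; apply/negP=> /andP[eY]; rewrite inE => /andP[eA /cards2P[a [b [ab eE]]]].
move: eA; rewrite eE subUset !sub1set => /andP[aA bA].
by move: nAA => /forall_inP/(_ a aA)/forall_inP/(_ b bA); rewrite /adj -eE eY.
Qed.

(** The distribution of a random set that contains each vertex independently with
    probability [q]. *)
Definition bern q S : R := \prod_(z : 'I_n) (if z \in S then q else 1 - q).

Lemma bern_ge0 q S : 0 <= q <= 1 -> 0 <= bern q S.
Proof.
by case/andP=> q0 q1; apply: prodr_ge0 => z _; case: ifP => _; rewrite ?subr_ge0.
Qed.

Lemma sum_bern q : \sum_(S : {set 'I_n}) bern q S = 1.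
Proof. by rewrite -bigA_distr big1 // => z _; rewrite /= subrKC. Qed.

Lemma bern_avoid q A :
  \sum_(S : {set 'I_n} | [disjoint S & A]) bern q S = (1 - q) ^+ #|A|.
Proof.
transitivity (\sum_(S : {set 'I_n}) \prod_(z : 'I_n)
    (if z \in S then (if z \in A then 0 else q) else 1 - q)).
  rewrite big_mkcond; apply: eq_bigr => S _; rewrite /bern.
  case: ifPn => [dSA|/pred0Pn[z /= /andP[zS zA]]].
    by apply: eq_bigr => z _; case: ifP => // zS; rewrite (disjointFr dSA zS).
  by rewrite (bigD1 z) //= zS zA mul0r.
rewrite -bigA_distr -prodr_const [RHS]big_mkcond; apply: eq_bigr => z _.
by rewrite /=; case: ifP; rewrite ?add0r ?subrKC.
Qed.

Lemma bern_mgf q t : \sum_(S : {set 'I_n}) bern q S * t ^+ #|S| = (q * t + (1 - q)) ^+ n.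
Proof.
transitivity (\sum_(S : {set 'I_n}) \prod_(z : 'I_n) (if z \in S then q * t else 1 - q)).
  apply: eq_bigr => S _; rewrite /bern -prodr_const [X in _ * X]big_mkcond -big_split /=.
  by apply: eq_bigr => z _; case: ifP; rewrite ?mulr1.
by rewrite -bigA_distr prodr_const card_ord.
Qed.

(** The exponential moment [E 2^(-|S|)] gives the lower tail of the size. *)
Lemma bern_small_le q k : 0 <= q <= 1 ->
  \sum_(S : {set 'I_n} | (#|S| < k)%N) bern q S <= 2 ^+ k * expR (- (n%:R * q / 2)).
Proof.
move=> q01; have [q0 q1] := andP q01.
apply: (@le_trans _ _ (2 ^+ k * \sum_(S : {set 'I_n}) bern q S * (2^-1) ^+ #|S|)).
  rewrite mulr_sumr big_mkcond; apply: ler_sum => S _.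
  have bS := bern_ge0 S q01.
  case: ifP => [Sk|_]; last by rewrite !mulr_ge0 ?exprn_ge0.
  rewrite mulrCA ler_peMr // -(subnK (ltnW Sk)) exprD -mulrA -exprMn.
  by rewrite divff // expr1n mulr1 exprn_ege1 // ler1n.
rewrite ler_pM2l ?exprn_gt0 // bern_mgf.
have -> : q * 2^-1 + (1 - q) = 1 - q / 2 by field.
have -> : - (n%:R * q / 2) = n%:R * (- (q / 2)) by field.
rewrite expRM_natl; apply: lerXn2r; rewrite ?nnegrE ?expR_ge0 //; first lra.
by rewrite -[leRHS]/(expR (- (q / 2))) expR_ge1Dx.
Qed.

Lemma bern_imset q (f : {perm 'I_n}) S : bern q (f @: S) = bern q S.
Proof.
rewrite /bern (reindex_inj (@perm_inj _ f)) /=; apply: eq_bigr => z _.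
by rewrite mem_imset //; exact: perm_inj.
Qed.

(** A digraph is given by its out-neighbourhoods; loops are allowed, so that
    the out-neighbourhoods are independent and identically distributed. *)
Definition digraph := {ffun 'I_n -> {set 'I_n}}.

Definition arcs_w q (D : digraph) : R := \prod_(c : 'I_n) bern q (D c).

Lemma arcs_w_ge0 q D : 0 <= q <= 1 -> 0 <= arcs_w q D.
Proof. by move=> q01; apply: prodr_ge0 => c _; apply: bern_ge0. Qed.

Lemma sum_arcs_prod q (F : 'I_n -> {set 'I_n} -> R) :
  \sum_(D : digraph) arcs_w q D * \prod_c F c (D c) =
  \prod_c \sum_(S : {set 'I_n}) bern q S * F c S.
Proof.
by rewrite bigA_distr_bigA /=; apply: eq_bigr => D _; rewrite -big_split.
Qed.

Definition arc_edges (D : digraph) : {set {set 'I_n}} :=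
  [set e in pairs 'I_n | [exists c, exists z, (z \in D c) && (e == [set c; z])]].

Lemma arc_edges_pairs D : arc_edges D \subset pairs 'I_n.
Proof. by apply/subsetP=> e; rewrite inE => /andP[]. Qed.

Definition undirected D := SGraph (arc_edges_pairs D).

Lemma adj_undirected (D : digraph) (c z : 'I_n) : z \in D c -> c != z -> adj (undirected D) c z.
Proof.
move=> zD cz; rewrite /adj /= inE inE cards2 cz /=.
by apply/existsP; exists c; apply/existsP; exists z; rewrite zD eqxx.
Qed.

(** Every pair of vertices carries two arcs. *)
Lemma prod_arcs_pairs (F : {set 'I_n} -> R) :
  \prod_(c : 'I_n) \prod_(z : 'I_n) (if [set c; z] \in pairs 'I_n then F [set c; z] else 1)
  = \prod_(e in pairs 'I_n) F e ^+ 2.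
Proof.
rewrite pair_big /= -big_mkcond /=.
rewrite (partition_big (fun u : 'I_n * 'I_n => [set u.1; u.2]) [in pairs 'I_n]) //=.
apply: eq_bigr => e; rewrite inE => /cards2P[a [b [ab ->]]].
rewrite (bigD1 (a, b)) /=; last by rewrite inE cards2 ab !eqxx.
rewrite (bigD1 (b, a)) /=; last first.
  by rewrite inE cards2 [b == a]eq_sym ab setUC !eqxx /= xpair_eqE negb_and eq_sym ab.
rewrite big1 ?mulr1 ?expr2; first by rewrite [[set b; a]]setUC.
case=> c z /= /andP[/andP[/andP[cz /eqP/setP ce] cab] cba].
move: cab cba cz; rewrite !xpair_eqE inE cards2.
have := ce c; have := ce z; rewrite !inE !eqxx !orbT /=.
move=> /esym/orP[] /eqP-> /esym/orP[] /eqP->; rewrite ?eqxx ?andbF //=.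
Qed.

Lemma arcs_avoid q (E : {set {set 'I_n}}) : E \subset pairs 'I_n ->
  \sum_(D : digraph | [disjoint arc_edges D & E]) arcs_w q D =
  \prod_(e in pairs 'I_n) (if e \in E then (1 - q) ^+ 2 else 1).
Proof.
move=> sE.
pose F c S : R := \prod_(z : 'I_n) (if z \in S then ([set c; z] \notin E)%:R else 1).
transitivity (\sum_(D : digraph) arcs_w q D * \prod_c F c (D c)).
  rewrite big_mkcond; apply: eq_bigr => D _.
  case: ifPn => [dDE|/pred0Pn[e /= /andP[+ eE]]].
    rewrite big1 ?mulr1 // => c _; rewrite /F big1 // => z _; case: ifP => // zD.
    have [eE|//] := boolP (_ \in E).
    have : [set c; z] \in arc_edges D.
      rewrite inE (subsetP sE) //=; apply/existsP; exists c; apply/existsP; exists z.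
      by rewrite zD eqxx.
    by rewrite (disjointFl dDE eE).
  rewrite inE => /andP[eP /existsP[c /existsP[z /andP[zD /eqP ecz]]]].
  by rewrite (bigD1 c) //= {1}/F (bigD1 z) //= zD -ecz eE !mul0r mulr0.
rewrite sum_arcs_prod.
transitivity (\prod_(c : 'I_n) \prod_(z : 'I_n) (if [set c; z] \in pairs 'I_n
   then (if [set c; z] \in E then 1 - q else 1) else 1)); last first.
  rewrite (prod_arcs_pairs (fun e => if e \in E then 1 - q else 1)); by apply: eq_bigr => e _; case: ifP => // _; rewrite expr1n.
apply: eq_bigr => c _; rewrite /F.
transitivity (\sum_(S : {set 'I_n}) \prod_(z : 'I_n)
    (if z \in S then q * ([set c; z] \notin E)%:R else 1 - q)).
  apply: eq_bigr => S _; rewrite /bern -big_split /=; apply: eq_bigr => z _.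
  by case: ifP; rewrite ?mulr1.
rewrite -bigA_distr; apply: eq_bigr => z _ /=.
have [eE|eE] := boolP (_ \in E); first by rewrite (subsetP sE _ eE) mulr0 add0r.
by rewrite mulr1 subrKC; case: ifP.
Qed.

(** A pair is a non-edge of the underlying graph when both its arcs are absent,
    which has probability [(1 - q)^2 = 1 - p]. By [arcs_avoid] the underlying
    graph misses a set of pairs with the same probability as a random graph;
    by inclusion and exclusion these probabilities determine the distribution. *)
Lemma gnp_arcs p q (Q : pred (sgraph 'I_n)) : (1 - q) ^+ 2 = 1 - p ->
  \sum_(X : sgraph 'I_n | Q X) gnp p X =
  \sum_(D : digraph | Q (undirected D)) arcs_w q D.
Proof.
move=> qp; rewrite [RHS](partition_big undirected Q) //=; apply: eq_bigr => X QX.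
(* The indicator of [undirected D = X] is the product over all pairs of
   [b e * avoid D e + a e]; expanding it over subsets G of the pairs leaves the
   probabilities of avoiding G. *)
pose a (e : {set 'I_n}) : R := if e \in edges X then 1 else 0.
pose b (e : {set 'I_n}) : R := if e \in edges X then -1 else 1.
pose avoid (D : digraph) e : R := (e \notin arc_edges D)%:R.
have ind (D : digraph) : \prod_(e in pairs 'I_n) (b e * avoid D e + a e)
    = (undirected D == X)%:R.
  have [DX|DX] := eqVneq (undirected D) X.
    rewrite big1 // => e _; rewrite /a /b /avoid -DX /=.
    by case: ifP; rewrite ?mulr0 ?add0r ?mulr1 ?addr0.
  have [e eP eDX] : exists2 e, e \in pairs 'I_n & (e \in arc_edges D) != (e \in edges X).
    have : arc_edges D != edges X.
      by apply: contraNneq DX => DXE; apply/eqP/val_inj.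
    apply: contraNP => no; apply/eqP/setP=> e.
    have [eP|eP] := boolP (e \in pairs 'I_n).
      by apply/eqP; apply: contraPT no => eDX; case; exists e.
    rewrite (negPf (contra (subsetP (arc_edges_pairs D) e) eP)).
    by rewrite (negPf (contra (subsetP (edges_pairs X) e) eP)).
  rewrite (bigD1 e) //= /a /b /avoid.
  by move: eDX; do 2![case: (_ \in _)] => //= _; rewrite ?mulr1 ?mulr0 ?addNr ?addr0 mul0r.
transitivity (\sum_(D : digraph) arcs_w q D * (undirected D == X)%:R); last first.
  rewrite [RHS]big_mkcond; apply: eq_bigr => D _ /=.
  by case: eqP => [->|_]; rewrite ?QX ?mulr1 ?andbF ?mulr0.
transitivity (\sum_(D : digraph) arcs_w q D * \sum_(G : sgraph 'I_n)
   \prod_(e in pairs 'I_n) (if e \in edges G then b e * avoid D e else a e)); last first.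
  by apply: eq_bigr => D _; rewrite sum_graph_prod ind.
under [RHS]eq_bigr do rewrite mulr_sumr.
rewrite exchange_big /=.
transitivity (\sum_(G : sgraph 'I_n) \prod_(e in pairs 'I_n)
   (if e \in edges G then b e * (1 - q) ^+ 2 else a e)).
  rewrite sum_graph_prod /gnp; apply: eq_bigr => e _; rewrite /a /b qp.
  by case: ifP => _; [ring | rewrite mul1r addr0].
apply: eq_bigr => G _.
pose ab e := if e \in edges G then b e else a e.
transitivity (\prod_(e in pairs 'I_n) ab e *
   \prod_(e in pairs 'I_n) (if e \in edges G then (1 - q) ^+ 2 else 1)).
  rewrite -big_split; apply: eq_bigr => e _; rewrite /ab /=.
  by case: ifP; rewrite ?mulr1.
rewrite -arcs_avoid ?edges_pairs // mulr_sumr big_mkcond; apply: eq_bigr => D _ /=.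
case: ifPn => [dDG|/pred0Pn[e /= /andP[eD eG]]].
  rewrite mulrC; congr (_ * _); apply: eq_bigr => e _; rewrite /ab.
  by case: ifP => // eG; rewrite /avoid (disjointFl dDG eG) mulr1.
rewrite (bigD1 e) /=; last exact: subsetP (edges_pairs G) e eG.
by rewrite eG /avoid eD /= mulr0 mul0r mulr0.
Qed.
End RandomGraph.

(** * Failure of all trials *)

Section Connectivity.
Variables (R : realType) (n : nat).
Implicit Types (p q r theta small : R) (X Y : sgraph 'I_n) (A B S Z : {set 'I_n}).

Lemma sum_exprn_card (t : R) : \sum_(A : {set 'I_n}) t ^+ #|A| = (1 + t) ^+ n.
Proof.
transitivity (\sum_(A : {set 'I_n}) \prod_(z : 'I_n) (if z \in A then t else 1)).
  by apply: eq_bigr => A _; rewrite -big_mkcond prodr_const.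
by rewrite -bigA_distr prodr_const card_ord addrC.
Qed.

Lemma exprD1n_le_expR (t : R) : 0 <= t -> (1 + t) ^+ n <= expR (n%:R * t).
Proof.
move=> t0; rewrite expRM_natl; apply: lerXn2r; rewrite ?nnegrE ?expR_ge0 ?addr_ge0 //.
exact: expR_ge1Dx.
Qed.

(** For small [r] this bounds a union over all nonempty sets [A] of events of
    probability [r^(2 |A|)]. *)
Lemma sum_nonempty_le r : 0 <= r <= 1 ->
  \sum_(A : {set 'I_n} | A != set0) (r ^+ 2) ^+ #|A| <= r * expR (n%:R * r).
Proof.
move=> /andP[r0 r1]; apply: (@le_trans _ _ (r * \sum_(A : {set 'I_n}) r ^+ #|A|)).
  rewrite mulr_sumr big_mkcond; apply: ler_sum => A _; case: ifP => [A0|_].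
    rewrite -exprM mulnC exprM expr2 ler_wpM2r ?exprn_ge0 //.
    by rewrite -card_gt0 in A0; rewrite -(prednK A0) exprS ler_piMr // exprn_ile1.
  by rewrite mulr_ge0 ?exprn_ge0.
by rewrite ler_wpM2l // sum_exprn_card exprD1n_le_expR.
Qed.

Lemma card_small_sets_le : (0 < n)%N -> \sum_(Z : {set 'I_n} | (#|Z| <= 5)%N) (1 : R) <= expR 1 * n%:R ^+ 5.
Proof.
move=> n0; have nR : 0 < n%:R :> R by rewrite ltr0n.
apply: (@le_trans _ _ (n%:R ^+ 5 * \sum_(Z : {set 'I_n}) (n%:R^-1 : R) ^+ #|Z|)).
  rewrite mulr_sumr big_mkcond; apply: ler_sum => Z _; case: ifP => [Z5|_].
    rewrite exprVn -exprB // ?unitfE ?gt_eqF //; apply: exprn_ege1; by rewrite ler1n.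
  by rewrite mulr_ge0 ?exprn_ge0 // invr_ge0 ltW.
rewrite mulrC ler_wpM2r ?exprn_ge0 ?(ltW nR) // sum_exprn_card.
apply: le_trans (exprD1n_le_expR _) _; first by rewrite invr_ge0 ltW.
by rewrite divff // gt_eqF.
Qed.

(** A set [A] that is cut off from [S], or an independent subset [A] of [S],
    forces at least [m |A|] non-edges; sum over all choices of [A] and of the
    deleted set. *)
Lemma gnp_not_robust_le p r m S : 0 <= p <= 1 -> 0 <= r <= 1 -> (0 < n)%N -> (1 < m)%N ->
  (1 - p) ^+ m <= r ^+ 2 -> (12 * m <= #|S|)%N ->
  \sum_(Y : sgraph 'I_n | ~~ robust Y S) gnp p Y
    <= (expR 1 * n%:R ^+ 5 + 1) * (r * expR (n%:R * r)).
Proof.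
move=> p01 r01 n0 m1 pm Sm; have [p0 p1] := andP p01; have [r0 r1] := andP r01.
have g0 Y : 0 <= gnp p Y by apply: gnp_ge0.
have powle A j : (#|A| * m <= j)%N -> (1 - p) ^+ j <= (r ^+ 2) ^+ #|A|.
  move=> Aj; apply: (@le_trans _ _ ((1 - p) ^+ (m * #|A|))).
    by rewrite ler_wiXn2l ?subr_ge0 // ?lerBlDr ?lerDl // mulnC.
  by rewrite exprM lerXn2r ?nnegrE ?exprn_ge0 ?subr_ge0.
pose exp_fail (Z : {set 'I_n}) Y := [exists A : {set 'I_n},
  ((A != set0) && (3 * #|A| <= 2 * #|S|)%N) && no_edge Y A (S :\: (Z :|: A))].
pose ent_fail Y := [exists A : {set 'I_n},
  ((A \subset S) && (#|S| <= 4 * #|A|)%N) && no_edge Y A A].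
apply: (@le_trans _ _ (\sum_(Y : sgraph 'I_n |
    [exists Z : {set 'I_n}, (#|Z| <= 5)%N && exp_fail Z Y] || ent_fail Y) gnp p Y)).
  apply: sum_pred_le => // Y; rewrite /robust.
  have -> /= : (24 <= #|S|)%N by apply: leq_trans Sm; rewrite (@leq_pmul2l 12 2).
  rewrite negb_and => /orP[/forallPn[Z /forallPn[A]]|/forallPn[A]].
    rewrite negb_imply negbK => /andP[/and3P[Z5 A0 A3] nAS].
    apply/orP; left; apply/existsP; exists Z; rewrite Z5; apply/existsP; exists A.
    by rewrite A0 A3.
  rewrite negb_imply negbK => /andP[A4 nAA].
  by apply/orP; right; apply/existsP; exists A; rewrite A4.
apply: le_trans (sum_or_le _ _ g0) _; rewrite mulrDl mul1r; apply: lerD; last first.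
  apply: le_trans (sum_exists_le _ _ g0) _.
  apply: le_trans (sum_nonempty_le r01).
  rewrite [leRHS]big_mkcond [leLHS]big_mkcond; apply: ler_sum => A _ /=.
  case: ifP => [/andP[_ A4]|_]; last by case: ifP => // _; rewrite !exprn_ge0.
  have Am : (3 * m <= #|A|)%N.
    by rewrite -(@leq_pmul2l 4) // mulnA; apply: leq_trans A4.
  have A0 : (0 < #|A|)%N by apply: leq_trans Am; rewrite muln_gt0 /= (ltnW m1).
  rewrite -card_gt0 A0; apply: le_trans (gnp_no_edge_inside_le _ p01) _; apply: powle.
  rewrite bin2 -(doubleK (#|A| * m)%N); apply: half_leq.
  rewrite -muln2 -mulnA leq_mul2l; apply/orP; right.
  by move: (#|A|) Am m1 => a; lia.
apply: le_trans (sum_exists_le _ _ g0) _.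
apply: (@le_trans _ _ (\sum_(Z : {set 'I_n} | (#|Z| <= 5)%N) (1 : R) * (r * expR (n%:R * r)))); last first.
  by rewrite -mulr_suml ler_wpM2r ?card_small_sets_le // mulr_ge0 ?expR_ge0.
apply: ler_sum => Z Z5; rewrite mul1r; apply: le_trans (sum_exists_le _ _ g0) _.
apply: le_trans (sum_nonempty_le r01).
rewrite [leRHS]big_mkcond [leLHS]big_mkcond; apply: ler_sum => A _ /=.
case: ifP => [/andP[A0 A3]|_]; last by case: ifP => // _; rewrite !exprn_ge0.
rewrite A0; apply: le_trans (gnp_no_edge_le p01 _) _; last apply: powle.
  by rewrite disjoint_sym disjoints_subset; apply/subsetP=> z; rewrite !inE negb_or => /andP[/andP[_ ->]].
rewrite leq_mul2l; apply/orP; right; rewrite cardsD.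
have := leq_trans (subset_leq_card (subsetIr S (Z :|: A))) (leq_card_setU _ _).
move: (#|S :&: _|)%N (#|Z|)%N (#|A|)%N (#|S|)%N Z5 A3 Sm m1; clear.
by move=> i z a s; lia.
Qed.

Lemma expected_not_robust_le p q r m : 0 <= p <= 1 -> 0 <= q <= 1 -> 0 <= r <= 1 ->
  (0 < n)%N -> (1 < m)%N -> (1 - p) ^+ m <= r ^+ 2 ->
  \sum_(Y : sgraph 'I_n) gnp p Y * \sum_(S : {set 'I_n} | ~~ robust Y S) bern q S
    <= \sum_(S : {set 'I_n} | (#|S| < 12 * m)%N) bern q S
       + (expR 1 * n%:R ^+ 5 + 1) * (r * expR (n%:R * r)).
Proof.
move=> p01 q01 r01 n0 m1 pm; have [r0 r1] := andP r01; set K := (X in _ <= _ + X).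
have K0 : 0 <= K by rewrite !mulr_ge0 ?addr_ge0 ?mulr_ge0 ?expR_ge0 ?exprn_ge0.
have b0 S : 0 <= bern q S by apply: bern_ge0.
have g0 Y : 0 <= gnp p Y by apply: gnp_ge0.
under eq_bigr do rewrite mulr_sumr big_mkcond.
rewrite exchange_big /=.
apply: (@le_trans _ _ (\sum_(S : {set 'I_n})
   ((if (#|S| < 12 * m)%N then bern q S else 0) + bern q S * K))).
  apply: ler_sum => S _; case: ltnP => Sm.
    apply: (@le_trans _ _ (\sum_(Y : sgraph 'I_n) gnp p Y * bern q S)).
      by apply: ler_sum => Y _; case: ifP => // _; rewrite mulr_ge0.
    by rewrite -mulr_suml gnp_sum1 mul1r lerDl mulr_ge0.
  rewrite add0r -big_mkcond /= -mulr_suml mulrC ler_wpM2l //.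
  exact: gnp_not_robust_le pm Sm.
by rewrite big_split /= -mulr_suml sum_bern mul1r -big_mkcond.
Qed.

Lemma sum_markov_le (T : finType) (w g : T -> R) (a : R) : 0 < a ->
  (forall t, 0 <= w t) -> (forall t, 0 <= g t) ->
  \sum_(t | a < g t) w t <= (\sum_t w t * g t) / a.
Proof.
move=> a0 w0 g0; rewrite ler_pdivlMr // mulr_suml big_mkcond.
apply: ler_sum => t _; case: ifP => [/ltW ag|_]; last by rewrite mulr_ge0.
by rewrite ler_wpM2l.
Qed.

(** [S] is the out-neighbourhood of [c], and [A] and [B] are those of [x] and
    [y]. *)
Definition trial_fails Y (f : {perm 'I_n}) (x y c : 'I_n) (A B S : {set 'I_n}) :=
  [|| ~~ robust Y (f @: S), [disjoint S & A :\: [set c; x; y]]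
    | [disjoint S & B :\: [set c; x; y]]].

Lemma trial_exchange Y (f : {perm 'I_n}) (x y c : 'I_n) (D : digraph n) :
  x != y -> c != x -> c != y -> ~~ trial_fails Y f x y c (D x) (D y) (D c) ->
  connect (FS (undirected D) Y) f (tperm x y * f)%g.
Proof.
move=> xy cx cy; rewrite !negb_or negbK => /and3P[rob].
case/pred0Pn=> b /= /andP[bc]; rewrite inE => /andP[bN bx].
case/pred0Pn=> b' /= /andP[b'c]; rewrite inE => /andP[b'N b'y].
have [bxN b'yN] : x != b /\ y != b'.
  by move: bN b'N; rewrite !inE !negb_or => /andP[/andP[_ ?] _] /andP[_ ?]; rewrite !(eq_sym _ b) !(eq_sym _ b').
apply: (@FS_exchange_trial _ _ Y f x y c (D c) b b') => //.
- by move=> z zD zc; apply: adj_undirected => //; rewrite eq_sym.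
- by rewrite in_setD bN.
- exact: adj_undirected.
- by rewrite in_setD b'N.
- exact: adj_undirected.
Qed.

Lemma trial_fails_le q theta k Y (f : {perm 'I_n}) (x y c : 'I_n) (A B : {set 'I_n}) : 0 <= q <= 1 ->
  \sum_(S : {set 'I_n} | ~~ robust Y S) bern q S <= theta ->
  (k <= #|A|)%N -> (k <= #|B|)%N ->
  \sum_(S : {set 'I_n} | trial_fails Y f x y c A B S) bern q S
    <= theta + 2 * (1 - q) ^+ (k - 3).
Proof.
move=> q01 good kA kB; have b0 S : 0 <= bern q S by apply: bern_ge0.
have [q0 q1] := andP q01.
apply: le_trans (sum_or_le _ _ b0) _; apply: lerD.
  apply: le_trans good; rewrite (reindex_inj (imset_inj (@perm_inj _ f^-1))) /=.
  rewrite le_eqVlt; apply/orP; left; apply/eqP; apply: eq_big => [S|S _].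
    by rewrite -imset_comp; congr (~~ robust _ _); rewrite -[RHS]imset_id; apply: eq_imset => z; rewrite /= permKV.
  exact: bern_imset.
have avoid (E : {set 'I_n}) : (k <= #|E|)%N ->
    \sum_(S : {set 'I_n} | [disjoint S & E :\: [set c; x; y]]) bern q S <= (1 - q) ^+ (k - 3).
  move=> kE; rewrite bern_avoid ler_wiXn2l ?subr_ge0 ?lerBlDr ?lerDl //.
  rewrite cardsD; apply: leq_sub => //; apply: leq_trans (subset_leq_card (subsetIr _ _)) _.
  by rewrite -setUA !cardsU1 cards1; case: (_ \notin _); case: (_ \notin _).
by apply: le_trans (sum_or_le _ _ b0) _; rewrite mulr_natl mulr2n; apply: lerD; apply: avoid.
Qed.

(** Conditionally on the out-neighbourhoods of [x] and [y], the trials at the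
    other positions are independent. *)
Lemma all_trials_fail_le q theta k Y (f : {perm 'I_n}) (x y : 'I_n) : 0 <= q <= 1 -> x != y ->
  \sum_(S : {set 'I_n} | ~~ robust Y S) bern q S <= theta ->
  \sum_(D : digraph n | [&& (k <= #|D x|)%N, (k <= #|D y|)%N
     & [forall (c | (c != x) && (c != y)), trial_fails Y f x y c (D x) (D y) (D c)]]) arcs_w q D
    <= (theta + 2 * (1 - q) ^+ (k - 3)) ^+ (n - 2).
Proof.
move=> q01 xy good; set eta := theta + _; have [q0 q1] := andP q01.
have b0 S : 0 <= bern q S by apply: bern_ge0.
have eta0 : 0 <= eta.
  by rewrite addr_ge0 ?mulr_ge0 ?exprn_ge0 ?subr_ge0 //; apply: le_trans good; apply: sumr_ge0.
rewrite (partition_big (fun D : digraph n => (D x, D y))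
  (fun u => (k <= #|u.1|)%N && (k <= #|u.2|)%N)) /=; last by move=> D /and3P[-> ->].
apply: (@le_trans _ _ (\sum_(u : {set 'I_n} * {set 'I_n}) bern q u.1 * bern q u.2 * eta ^+ (n - 2))).
  rewrite big_mkcond; apply: ler_sum => -[A B] _ /=.
  case: ifP => [/andP[kA kB]|_]; last by rewrite !mulr_ge0 ?exprn_ge0.
  pose F c S : R := if c == x then (S == A)%:R else if c == y then (S == B)%:R
    else (trial_fails Y f x y c A B S)%:R.
  apply: (@le_trans _ _ (\sum_(D : digraph n) arcs_w q D * \prod_c F c (D c))).
    rewrite big_mkcond; apply: ler_sum => D _.
    have F0 : 0 <= \prod_c F c (D c) by apply: prodr_ge0 => c _; rewrite /F; do 2?case: ifP.
    case: ifP => [/andP[/and3P[_ _ /forall_inP fails] /eqP[DA DB]]|_]; last by rewrite mulr_ge0 ?arcs_w_ge0.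
    rewrite big1 ?mulr1 // => c _; rewrite /F.
    case: (eqVneq c x) => [->|cx]; first by rewrite DA eqxx.
    case: (eqVneq c y) => [->|cy]; first by rewrite DB eqxx.
    by rewrite -DA -DB fails // cx.
  rewrite sum_arcs_prod (bigD1 x) //= (bigD1 y) /=; last by rewrite eq_sym.
  have pick E : \sum_(S : {set 'I_n}) bern q S * (S == E)%:R = bern q E.
    by rewrite (bigD1 E) //= eqxx mulr1 big1 ?addr0 // => S /negPf->; rewrite mulr0.
  rewrite mulrA; apply: ler_pM.
  - by rewrite mulr_ge0 //; apply: sumr_ge0 => S _; rewrite mulr_ge0 // /F; do 2?case: ifP.
  - by apply: prodr_ge0 => c _; apply: sumr_ge0 => S _; rewrite mulr_ge0 // /F; do 2?case: ifP.
  - by rewrite /F eqxx eq_sym (negPf xy) eqxx !pick.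
  have cardc : #|[pred c : 'I_n | (c != x) && (c != y)]| = (n - 2)%N.
    have := cardC (pred2 x y); rewrite card2 xy card_ord => E.
    have aux a b : (2 + a = b -> a = b - 2)%N by lia.
    by rewrite -(aux _ _ E); apply: eq_card => c; rewrite !inE negb_or.
  rewrite -cardc -prodr_const; apply: ler_prod => c /andP[cx cy].
  rewrite sumr_ge0 /=; last by move=> S _; rewrite mulr_ge0 // /F; do 2?case: ifP.
  apply: le_trans (trial_fails_le f x y c q01 good kA kB).
  rewrite [leRHS]big_mkcond; apply: ler_sum => S _; rewrite /F (negPf cx) (negPf cy).
  by case: ifP; rewrite ?mulr1 ?mulr0.
rewrite -mulr_suml -(pair_big predT predT (fun A B => bern q A * bern q B)) /=.
under eq_bigr do rewrite -mulr_sumr sum_bern mulr1.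
by rewrite sum_bern mul1r.
Qed.

Lemma arcs_small_le q k : 0 <= q <= 1 ->
  \sum_(D : digraph n | [exists c, (#|D c| < k)%N]) arcs_w q D
    <= n%:R * \sum_(S : {set 'I_n} | (#|S| < k)%N) bern q S.
Proof.
move=> q01; have b0 S : 0 <= bern q S by apply: bern_ge0.
apply: le_trans (@sum_exists_le R _ _ predT _ _ (fun D => arcs_w_ge0 D q01)) _.
rewrite mulr_natl -[X in _ *+ X]card_ord -sumr_const; apply: ler_sum => c _.
pose F c' (S : {set 'I_n}) : R := if c' == c then (#|S| < k)%N%:R else 1.
rewrite [leLHS](_ : _ = \sum_(D : digraph n) arcs_w q D * \prod_c' F c' (D c')).
  rewrite sum_arcs_prod (bigD1 c) //= [X in _ * X]big1 ?mulr1.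
    rewrite /F eqxx [leRHS]big_mkcond; apply: ler_sum => S _.
    by case: ifP; rewrite ?mulr1 ?mulr0.
  move=> c' /negPf cc'; rewrite /F cc' -[RHS](sum_bern n q).
  by apply: eq_bigr => S _; rewrite mulr1.
rewrite big_mkcond; apply: eq_bigr => D _ /=.
rewrite (bigD1 c) //= big1 ?mulr1 => [|c' /negPf cc']; last by rewrite /F cc'.
by rewrite /F eqxx -[eqn _ 0]/(#|D c| < k)%N; case: (_ < _)%N; rewrite ?mulr1 ?mulr0.
Qed.

(** Union bound over all placements and all pairs of positions, for a fixed graph
    [Y] for which random sets are robust up to probability [theta]. *)
Lemma gnp_disconnected_le p q theta k Y : 0 <= q <= 1 -> (1 - q) ^+ 2 = 1 - p ->
  \sum_(S : {set 'I_n} | ~~ robust Y S) bern q S <= theta ->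
  \sum_(X : sgraph 'I_n | ~~ FS_connected X Y) gnp p X <=
    n%:R * \sum_(S : {set 'I_n} | (#|S| < k)%N) bern q S
    + n%:R ^+ (n + 2) * (theta + 2 * (1 - q) ^+ (k - 3)) ^+ (n - 2).
Proof.
move=> q01 qp good; set eta := theta + _; have [q0 q1] := andP q01.
have b0 S : 0 <= bern q S by apply: bern_ge0.
have eta0 : 0 <= eta.
  by rewrite addr_ge0 ?mulr_ge0 ?exprn_ge0 ?subr_ge0 //; apply: le_trans good; apply: sumr_ge0.
rewrite (gnp_arcs _ qp).
pose fails (D : digraph n) (u : {perm 'I_n} * ('I_n * 'I_n)) :=
  let: (f, (x, y)) := u in [&& (k <= #|D x|)%N, (k <= #|D y|)%N
     & [forall (c | (c != x) && (c != y)), trial_fails Y f x y c (D x) (D y) (D c)]].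
apply: (@le_trans _ _ (\sum_(D : digraph n | [exists c, (#|D c| < k)%N] ||
   [exists u : {perm 'I_n} * ('I_n * 'I_n), (u.2.1 != u.2.2) && fails D u]) arcs_w q D)).
  apply: sum_pred_le => [D|D]; first exact: arcs_w_ge0.
  apply: contraNT; rewrite negb_or => /andP[/existsPn large /existsPn nofail].
  apply: FS_connected_exchange => f x y xy.
  have : ~~ ((x != y) && fails D (f, (x, y))) by exact: nofail.
  have kD z : (k <= #|D z|)%N by rewrite leqNgt large.
  rewrite xy /fails !kD => /forallPn[c]; rewrite negb_imply => /andP[/andP[cx cy]].
  exact: trial_exchange.
apply: le_trans (sum_or_le _ _ (fun D => arcs_w_ge0 D q01)) _.
apply: lerD; first exact: arcs_small_le.
apply: le_trans (sum_exists_le _ _ (fun D => arcs_w_ge0 D q01)) _.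
apply: (@le_trans _ _ (\sum_(u : {perm 'I_n} * ('I_n * 'I_n)) eta ^+ (n - 2))).
  rewrite big_mkcond; apply: ler_sum => -[f [x y]] _ /=.
  by case: ifP => [xy|_]; [apply: all_trials_fail_le | rewrite exprn_ge0].
rewrite sumr_const -[leLHS]mulr_natl ler_wpM2r ?exprn_ge0 // -natrX ler_nat.
rewrite !card_prod !card_ord expnD -mulnn; apply: leq_mul => //.
rewrite -[X in (_ <= X ^ _)%N](card_ord n) -[X in (_ <= _ ^ X)%N](card_ord n) -card_ffun.
exact: (@leq_card _ _ (val : {perm 'I_n} -> {ffun 'I_n -> 'I_n}) val_inj).
Qed.

(** Graphs [Y] for which random sets fail to be robust with probability more than
    [theta] are rare by Markov's inequality; the others are treated by
    [gnp_disconnected_le]. *)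
Lemma gnp_prob2_disconnected_le p q r theta small m : 0 <= p <= 1 -> 0 <= q <= 1 -> 0 <= r <= 1 ->
  (1 - q) ^+ 2 = 1 - p -> (0 < n)%N -> (1 < m)%N -> 0 < theta ->
  (1 - p) ^+ m <= r ^+ 2 ->
  \sum_(S : {set 'I_n} | (#|S| < 12 * m)%N) bern q S <= small ->
  gnp_prob2 p (fun X Y : sgraph 'I_n => ~~ FS_connected X Y) <=
    (small + (expR 1 * n%:R ^+ 5 + 1) * (r * expR (n%:R * r))) / theta
    + (n%:R * small
       + n%:R ^+ (n + 2) * (theta + 2 * (1 - q) ^+ (12 * m - 3)) ^+ (n - 2)).
Proof.
move=> p01 q01 r01 qp n0 m1 theta0 pm sm; have [q0 q1] := andP q01.
set beta := n%:R * small + _.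
have b0 S : 0 <= bern q S by apply: bern_ge0.
have g0 Y : 0 <= gnp p Y by apply: gnp_ge0.
have small0 : 0 <= small by apply: le_trans sm; apply: sumr_ge0.
have beta0 : 0 <= beta.
  rewrite addr_ge0 ?mulr_ge0 ?exprn_ge0 // addr_ge0 ?(ltW theta0) //.
  by rewrite mulr_ge0 ?exprn_ge0 ?subr_ge0.
pose risk Y := \sum_(S : {set 'I_n} | ~~ robust Y S) bern q S.
have -> : gnp_prob2 p (fun X Y : sgraph 'I_n => ~~ FS_connected X Y) =
    \sum_(Y : sgraph 'I_n) gnp p Y * \sum_(X : sgraph 'I_n | ~~ FS_connected X Y) gnp p X.
  rewrite /gnp_prob2; under eq_bigr do rewrite big_mkcond.
  rewrite exchange_big; apply: eq_bigr => Y _; rewrite mulr_sumr [RHS]big_mkcond.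
  by apply: eq_bigr => X _; case: ifP => // _; rewrite mulrC.
apply: (@le_trans _ _ (\sum_(Y : sgraph 'I_n)
    ((if theta < risk Y then gnp p Y else 0) + gnp p Y * beta))).
  apply: ler_sum => Y _; case: ltP => risky.
    apply: (@le_trans _ _ (gnp p Y * 1)); last by rewrite mulr1 lerDl mulr_ge0.
    rewrite ler_wpM2l // -(gnp_sum1 n p) big_mkcond; apply: ler_sum => X _.
    by case: ifP.
  rewrite add0r ler_wpM2l //; apply: le_trans (gnp_disconnected_le (12 * m) q01 qp risky) _.
  by rewrite lerD2r ler_wpM2l.
rewrite big_split /= -mulr_suml gnp_sum1 mul1r lerD2r -big_mkcond.
apply: le_trans (sum_markov_le theta0 g0 _) _; first by move=> Y; apply: sumr_ge0.
rewrite ler_pM2r ?invr_gt0 //; apply: le_trans (expected_not_robust_le p01 q01 r01 n0 m1 pm) _.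
by rewrite lerD2r.
Qed.
End Connectivity.

(** * Packing two graphs of small degree *)

Section Packing.
Variables (T : finType) (X Y : sgraph T).

Definition degree (G : sgraph T) (v : T) := #|[set w | adj G v w]|.

Lemma card_bigcup_le (I : finType) (D : pred I) (F : I -> {set T}) d :
  (forall i, D i -> (#|F i| <= d)%N) -> (#|\bigcup_(i | D i) F i| <= #|D| * d)%N.
Proof.
move=> Fd; rewrite -sum_nat_const; apply: (big_rec2 (fun (A : {set T}) s => (#|A| <= s)%N)).
  by rewrite cards0.
move=> i s A Di As; apply: leq_trans (leq_card_setU _ _) _; apply: leq_add As; exact: Fd.
Qed.

(** A placement [s] with the fewest coincidences (edges of [X] occupied by
    friends) has none: if [a b] is one, then trade the person at [a] with the
    one at a position [z] which is neither [b] nor reached from [a] by an edge of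
    [X] followed by a friendship or vice versa. At most [2 dX dY] positions are
    excluded, since [a] is reached in both ways, which makes up for [b]. The trade
    removes the coincidence [a b] and creates no other. *)
Lemma sauer_spencer dX dY : (forall v, (degree X v <= dX)%N) ->
  (forall v, (degree Y v <= dY)%N) -> (2 * dX * dY < #|T|)%N ->
  exists s : {perm T}, forall a b, adj X a b -> ~~ adj Y (s a) (s b).
Proof.
move=> degX degY small.
pose common (s : {perm T}) := [set u : T * T | adj X u.1 u.2 && adj Y (s u.1) (s u.2)].
case: (@arg_minnP _ (1%g : {perm T}) predT (fun s => #|common s|)) => // s _ smin.
exists s => a b Xab; apply/negP => Yab.
pose N1 := \bigcup_(w | adj X a w) [set z | adj Y (s w) (s z)].
pose N2 := \bigcup_(w | adj Y (s a) (s w)) [set z | adj X w z].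
have sdeg w : (#|[set z | adj Y (s w) (s z)]| <= dY)%N.
  apply: leq_trans (degY (s w)); rewrite /degree -(card_imset _ (@perm_inj _ s)).
  by apply/subset_leq_card/subsetP=> _ /imsetP[z zN ->]; move: zN; rewrite !inE.
have cN1 : (#|N1| <= dX * dY)%N.
  apply: leq_trans (card_bigcup_le (fun w _ => sdeg w)) _; apply: leq_mul => //.
  by apply: leq_trans (degX a); rewrite /degree cardsE.
have cN2 : (#|N2| <= dX * dY)%N.
  rewrite mulnC; apply: leq_trans (card_bigcup_le (fun w _ => degX w)) _.
  by apply: leq_mul => //; apply: leq_trans (sdeg a); rewrite cardsE.
have aN1 : a \in N1 by apply/bigcupP; exists b; rewrite // inE adjC.
have aN2 : a \in N2 by apply/bigcupP; exists b; rewrite // inE adjC.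
have [z] : exists z, z \in ~: (b |: (N1 :|: N2)).
  apply/card_gt0P; rewrite -(ltn_add2l #|b |: (N1 :|: N2)|) cardsC addn0.
  apply: leq_ltn_trans small; rewrite -mulnA mul2n -addnn.
  have aI : (0 < #|N1 :&: N2|)%N by apply/card_gt0P; exists a; rewrite inE aN1.
  have := cardsUI N1 N2; rewrite cardsU1; case: (b \notin _);
    by move: #|N1 :|: N2| #|N1 :&: N2| #|N1| #|N2| (dX * dY)%N aI cN1 cN2; clear => /=; lia.
rewrite !inE !negb_or => /and3P[zb zN1 zN2].
have far1 w : adj X a w -> adj Y (s w) (s z) = false.
  by move=> aw; apply: contraNF zN1 => wz; apply/bigcupP; exists w; rewrite ?inE.
have far2 w : adj Y (s a) (s w) -> adj X w z = false.
  by move=> aw; apply: contraNF zN2 => wz; apply/bigcupP; exists w; rewrite ?inE.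
have := smin (tperm a z * s)%g isT; rewrite leqNgt => /negP; apply.
apply/proper_card/properP; split; last first.
  exists (a, b); rewrite inE /= ?Xab ?Yab // !permM tpermL.
  by rewrite tpermD ?(adj_neq Xab) // adjC far1 // andbF.
apply/subsetP=> -[u v]; rewrite !inE /= !permM => /andP[Xuv]; rewrite Xuv /=.
case: tpermP => [ua|uz|/eqP ua /eqP uz]; case: tpermP => [va|vz|/eqP va /eqP vz] //; subst.
- by have := adj_neq Xuv; rewrite eqxx.
- by rewrite adjC.
- by rewrite adjC far1.
- by rewrite adjC.
- by have := adj_neq Xuv; rewrite eqxx.
- by move/far2; rewrite adjC Xuv.
- by rewrite far1 // adjC.
- by rewrite adjC => /far2; rewrite Xuv.
Qed.

Lemma packing_disconnected (s : {perm T}) : (1 < #|T|)%N ->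
  (forall a b, adj X a b -> ~~ adj Y (s a) (s b)) -> ~~ FS_connected X Y.
Proof.
move=> T2 pack; have /card_gt1P[x [y [_ _ xy]]] := T2.
apply/negP=> /forallP/(_ s)/forallP/(_ (tperm x y * s)%g)/connectP[[|g w] /=].
  move=> _ sE; have := congr1 (fun g : {perm T} => g x) sE.
  by rewrite permM tpermL => /perm_inj yx; rewrite yx eqxx in xy.
case/andP=> /existsP[a /existsP[b /and5P[Xab Yab _ _ _]]].
by move: Yab; rewrite (negPf (pack _ _ Xab)).
Qed.
End Packing.

(** * Large degrees are unlikely *)

Section Degrees.
Variables (R : realType) (n : nat).
Implicit Types (p t : R) (G X Y : sgraph 'I_n).

Lemma card_pairs_at (v : 'I_n) : (#|[set e in pairs 'I_n | v \in e]| <= n)%N.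
Proof.
rewrite -[X in (_ <= X)%N]card_ord -cardsT.
apply: leq_trans (leq_imset_card (fun w => [set v; w]) _); apply: subset_leq_card.
apply/subsetP=> e; rewrite !inE => /andP[/cards2P[a [b [_ ->]]]].
rewrite !inE => /orP[/eqP->|/eqP->]; apply/imsetP; [exists b | exists a] => //.
by rewrite setUC.
Qed.

Lemma degree_le_edges G v : (degree G v <= #|[set e in edges G | v \in e]|)%N.
Proof.
rewrite /degree -(card_in_imset (f := fun w => [set v; w])) => [|w w']; last first.
  rewrite !inE => /adj_neq vw /adj_neq vw' /setP/(_ w); rewrite !inE eqxx orbT.
  by rewrite eq_sym (negPf vw) => /esym/eqP.
apply/subset_leq_card/subsetP=> _ /imsetP[w + ->]; rewrite !inE eqxx /= andbT.
by [].
Qed.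

(** Exponential moments: [t] to the number of edges at [v]. *)
Lemma gnp_degree p t k : 0 <= p <= 1 -> 1 <= t ->
  \sum_(G : sgraph 'I_n | [exists v, (k <= degree G v)%N]) gnp p G
    <= n%:R * (expR (n%:R * (p * (t - 1))) / t ^+ k).
Proof.
move=> p01 t1; have [p0 p1] := andP p01; have t0 : 0 < t by apply: lt_le_trans t1.
have g0 G : 0 <= gnp p G by apply: gnp_ge0.
have pt0 : 0 <= p * (t - 1) by rewrite mulr_ge0 ?subr_ge0.
apply: le_trans (@sum_exists_le R _ _ predT _ _ g0) _.
rewrite mulr_natl -[X in _ *+ X]card_ord -sumr_const; apply: ler_sum => v _.
pose E G := [set e in edges G | v \in e].
apply: (@le_trans _ _ ((\sum_(G : sgraph 'I_n) gnp p G * t ^+ #|E G|) / t ^+ k)).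
  rewrite mulr_suml big_mkcond; apply: ler_sum => G _; rewrite -mulrA.
  case: ifPn => [kG|_]; last by rewrite mulr_ge0 // divr_ge0 // exprn_ge0 // ltW.
  rewrite ler_peMr // ler_pdivlMr ?exprn_gt0 // mul1r ler_weXn2l //.
  by apply: leq_trans kG _; apply: degree_le_edges.
rewrite ler_wpM2r ?invr_ge0 ?exprn_ge0 ?(ltW t0) //.
pose w (e : {set 'I_n}) : R := if v \in e then t else 1.
rewrite (_ : \sum_G _ = \prod_(e in pairs 'I_n) (p * w e + (1 - p))); last first.
  rewrite -sum_graph_prod; apply: eq_bigr => G _; rewrite /gnp -prodr_const.
  rewrite [X in _ * X](_ : _ = \prod_(e in pairs 'I_n | e \in E G) t); last first.
    apply: eq_bigl => e; rewrite [RHS]andb_idl // /E inE => /andP[eG _].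
    exact: subsetP (edges_pairs G) e eG.
  rewrite [X in _ * X]big_mkcondr -big_split; apply: eq_bigr => e _ /=; rewrite inE /w.
  by case: (e \in edges G) => //=; case: (v \in e); rewrite ?mulr1.
rewrite (bigID (fun e : {set 'I_n} => v \in e)) /= [X in _ * X]big1 ?mulr1; last first.
  by move=> e /andP[_ /negPf ve]; rewrite /w ve mulr1 subrKC.
apply: (@le_trans _ _ ((1 + p * (t - 1)) ^+ #|[set e in pairs 'I_n | v \in e]|)).
  rewrite -prodr_const le_eqVlt; apply/orP; left; apply/eqP.
  apply: eq_big => [e|e /andP[_ ve]]; first by rewrite inE.
  by rewrite /w ve; ring.
apply: le_trans (exprD1n_le_expR n pt0); rewrite ler_weXn2l ?lerDl //.
exact: card_pairs_at.
Qed.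

Lemma gnp_prob2C p (Q : rel (sgraph 'I_n)) :
  gnp_prob2 p Q = 1 - gnp_prob2 p (fun X Y => ~~ Q X Y).
Proof.
rewrite -(gnp_prob2T n p) /gnp_prob2 -sumrB; apply: eq_bigr => X _.
by rewrite [X in _ = X - _](bigID (Q X)) /= addrK.
Qed.

Lemma gnp_prob2_connected_le p t d : 0 <= p <= 1 -> 1 <= t -> (1 < n)%N -> (2 * d * d < n)%N ->
  gnp_prob2 p (fun X Y : sgraph 'I_n => ~~ ~~ FS_connected X Y)
    <= 2 * (n%:R * (expR (n%:R * (p * (t - 1))) / t ^+ d.+1)).
Proof.
move=> p01 t1 n1 dn; have g0 G : 0 <= gnp p G by apply: gnp_ge0.
pose big G := [exists v, (d.+1 <= degree G v)%N].
have bigP := gnp_degree d.+1 p01 t1.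
have bigN G : ~~ big G -> forall v, (degree G v <= d)%N.
  by move=> /existsPn small v; rewrite leqNgt small.
apply: (@le_trans _ _ (\sum_(X : sgraph 'I_n)
  ((if big X then gnp p X else 0) + gnp p X * \sum_(Y : sgraph 'I_n | big Y) gnp p Y))).
  apply: ler_sum => X _; rewrite -mulr_sumr; case: ifP => bX.
    apply: (@le_trans _ _ (gnp p X * 1)); last by rewrite mulr1 lerDl mulr_ge0 ?sumr_ge0.
    rewrite ler_wpM2l // -(gnp_sum1 n p) big_mkcond; apply: ler_sum => Y _.
    by case: ifP.
  rewrite add0r ler_wpM2l //; apply: sum_pred_le => // Y; rewrite negbK.
  apply: contraTT => bY.
  have [|s pack] := sauer_spencer (bigN X (negbT bX)) (bigN Y bY); first by rewrite card_ord.
  by apply: (packing_disconnected _ pack); rewrite card_ord.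
rewrite big_split /= -mulr_suml gnp_sum1 mul1r -big_mkcond mulr_natl mulr2n.
exact: lerD.
Qed.
End Degrees.

(** * Limits *)

Local Open Scope classical_set_scope.
Local Open Scope ring_scope.

Section Asymptotics.
Variable R : realType.
Implicit Types (p q eps C K : R) (n : nat).

Lemma cvg1_of_rate (u : nat -> R) C :
  (\forall n \near \oo, 0 <= 1 - u n <= C / n%:R) -> u @ \oo --> (1 : R).
Proof.
move=> uC.
have C0 : (fun n => C / n%:R) @ \oo --> (0 : R).
  rewrite -[X in _ --> X](mulr0 C); apply: cvgM; first exact: cvg_cst.
  apply/gtr0_cvgV0; last exact: cvgr_idn.
  by near=> n; rewrite ltr0n; near: n; exact: nbhs_infty_gt.
have : (fun n => 1 - u n) @ \oo --> (0 : R).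
  apply: (squeeze_cvgr (f := fun=> 0) (h := fun n => C / n%:R)) => //; exact: cvg_cst.
move=> /(cvgB (cvg_cst (1 : R))); rewrite subr0.
move=> cv; suff -> : u = (fun=> 1) \- (fun n => 1 - u n) by [].
by apply/funext => n /=; rewrite subKr.
Unshelve. all: by end_near.
Qed.

Lemma expR_ge_pow4 (y : R) : 0 <= y -> (y / 4) ^+ 4 <= expR y.
Proof.
move=> y0; have {2}-> : y = 4%:R * (y / 4) by rewrite mulrC divfK.
rewrite expRM_natl; apply: lerXn2r; rewrite ?nnegrE ?expR_ge0 ?divr_ge0 //.
by apply: le_trans (expR_ge1Dx _); rewrite lerDr.
Qed.

(** With [d] the largest number such that [2 d^2 < n] and [a = 2^(-1/2)], the
    mean degree is at most [(a - eps) sqrt n], while [d + 1 >= a sqrt n]. The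
    choice [t = 1 + eps / (2 a)] makes the exponent of the degree bound at
    most [- eps^2 / (4 a) sqrt n]. *)
Lemma gnp_prob2_connected_rate eps p n : 0 < eps -> eps < (Num.sqrt 2)^-1 -> 0 <= p <= 1 ->
  (1 < n)%N -> p <= ((Num.sqrt 2)^-1 - eps) / Num.sqrt n%:R ->
  gnp_prob2 p (fun X Y : sgraph 'I_n => ~~ ~~ FS_connected X Y)
    <= 512 / (eps ^+ 2 / (4 * (Num.sqrt 2)^-1)) ^+ 4 / n%:R.
Proof.
set a := (Num.sqrt 2)^-1; set c := eps ^+ 2 / (4 * a) => e0 ea p01 n1 pn.
set s := Num.sqrt n%:R in pn.
have nR : 0 < n%:R :> R by rewrite ltr0n ltnW.
have s0 : 0 < s by rewrite sqrtr_gt0.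
have ss : s ^+ 2 = n%:R by rewrite sqr_sqrtr // ltW.
have a0 : 0 < a by rewrite invr_gt0 sqrtr_gt0.
have aa : a ^+ 2 = 2^-1 by rewrite exprVn sqr_sqrtr.
have c0 : 0 < c by rewrite divr_gt0 ?exprn_gt0 ?mulr_gt0.
have [d dn nd] : exists2 d, (2 * d * d < n)%N & (n <= 2 * d.+1 * d.+1)%N.
  have ex : exists d, (2 * d * d < n)%N by exists 0%N; rewrite muln0 ltnW.
  have bd d : (2 * d * d < n)%N -> (d <= n)%N by case: d => // d; nia.
  case: (ex_maxnP ex bd) => d dn dmax; exists d => //.
  by rewrite leqNgt; apply/negP=> /dmax; rewrite ltnn.
pose x := eps / (2 * a); have x0 : 0 < x by rewrite divr_gt0 // mulr_gt0.
have ax : a * x = eps / 2 by rewrite /x; field; rewrite gt_eqF.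
have t0 : 0 < 1 + x by rewrite addr_gt0.
have lnt : x / (1 + x) <= ln (1 + x).
  have -> : x / (1 + x) = 1 - (1 + x)^-1 by field; rewrite gt_eqF.
  rewrite -[ln _]opprK -lnV ?posrE // lerNr opprB -[X in ln X](subrKC 1).
  by apply: le_ln1Dx; rewrite ltrBrDl subrr invr_gt0.
have sd : a * s <= d.+1%:R.
  rewrite -(@ler_pXn2r _ 2) ?nnegrE ?mulr_ge0 ?(ltW a0) ?(ltW s0) //.
  rewrite exprMn aa ss ler_pdivrMl // -natrX -natrM ler_nat.
  by apply: leq_trans nd _; rewrite -mulnn mulnA.
have := gnp_prob2_connected_le (t := 1 + x) p01 _ n1 dn.
rewrite lerDl (ltW x0) => /(_ isT) /le_trans; apply.
have -> : 1 + x - 1 = x by ring.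
have expo : expR (n%:R * (p * x)) / (1 + x) ^+ d.+1 <= expR (- (c * s)).
  rewrite -[X in _ / X ^+ _](lnK t0) -expRM_natl -expRN -expRD ler_expR.
  have H1 : n%:R * (p * x) <= s * ((a - eps) * x).
    rewrite -ss expr2 -mulrA ler_wpM2l ?(ltW s0) // mulrA ler_wpM2r ?(ltW x0) //.
    by rewrite mulrC -ler_pdivlMr.
  have H2 : a * s * (x / (1 + x)) <= d.+1%:R * ln (1 + x).
    by apply: ler_pM => //; [rewrite mulr_ge0 ?ltW | rewrite divr_ge0 ?ltW].
  apply: le_trans (lerB H1 H2) _.
  have -> : s * ((a - eps) * x) - a * s * (x / (1 + x)) = s * (x * (a * x / (1 + x) - eps)).
    by field; rewrite gt_eqF.
  have -> : - (c * s) = s * (x * (a * x - eps)).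
    rewrite ax /c /x; field; by rewrite gt_eqF.
  rewrite !ler_wpM2l ?(ltW s0) ?(ltW x0) // lerD2r ler_pdivrMr // ler_peMr ?lerDl ?(ltW x0) //.
  by rewrite ax divr_ge0 // ltW.
have cs0 : 0 < c * s by rewrite mulr_gt0.
have small : expR (- (c * s)) <= 256 / c ^+ 4 / n%:R ^+ 2.
  have -> : 256 / c ^+ 4 / n%:R ^+ 2 = ((c * s / 4) ^+ 4)^-1.
    by rewrite -ss; field; rewrite !gt_eqF.
  rewrite expRN lef_pV2 ?posrE ?expR_gt0 ?exprn_gt0 ?divr_gt0 //.
  exact: expR_ge_pow4 (ltW cs0).
have -> : 512 / c ^+ 4 / n%:R = 2 * (n%:R * (256 / c ^+ 4 / n%:R ^+ 2)).
  by field; rewrite !gt_eqF.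
rewrite ler_pM2l // ler_pM2l //; exact: le_trans expo small.
Qed.

Lemma sqrt_complement p : 0 <= p <= 1 ->
  exists q : R, [/\ 0 <= q <= 1, (1 - q) ^+ 2 = 1 - p & p / 2 <= q].
Proof.
move=> /andP[p0 p1]; have := sqrtr_ge0 (1 - p).
have : Num.sqrt (1 - p) ^+ 2 = 1 - p by rewrite sqr_sqrtr // subr_ge0.
move: (Num.sqrt _) => s ss s0; exists (1 - s).
have s1 : s <= 1 by nra.
by rewrite subKr; split; rewrite // ?subr_ge0 ?s1 ?lerBlDr ?lerDl //; nra.
Qed.

(** In [gnp_prob2_disconnected_le] take [m] about [n q / 48], [theta = n^-5] and
    [r = n^-11]; the constant 4224 makes every exponential error at most
    [n^-11]. *)
Lemma gnp_prob2_disconnected_rate p n : 0 <= p <= 1 -> (3 < n)%N -> 1 <= ln (n%:R : R) ->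
  4224 * ln (n%:R : R) <= n%:R * p ^+ 2 ->
  gnp_prob2 p (fun X Y : sgraph 'I_n => ~~ FS_connected X Y)
    <= (expR 1 ^+ 2 + expR 1 + 3) / n%:R.
Proof.
have [N NE] : exists N : R, n%:R = N by exists n%:R.
have [L LE] : exists L : R, ln N = L by exists (ln N).
rewrite NE LE => p01 n3 L1 np2; have [p0 p1] := andP p01.
have n0 : (0 < n)%N by apply: leq_trans n3.
have N0 : 0 < N by rewrite -NE ltr0n.
have N4 : 4 <= N by rewrite -NE ler_nat.
have [v vE] : exists v : R, N^-1 = v by exists N^-1.
have v0 : 0 < v by rewrite -vE invr_gt0.
have v4 : v <= 4^-1 by rewrite -vE lef_pV2 ?posrE.
have v1 : v <= 1 by apply: le_trans v4 _; rewrite invf_le1 ?ler1n.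
have Nv : N * v = 1 by rewrite -vE divff // gt_eqF.
have vL j : v ^+ j = expR (- (j%:R * L)).
  by rewrite -mulrN expRM_natl expRN -LE lnK ?posrE // vE.
have [q [q01 qp qp2]] := sqrt_complement p01; have [q0 q1] := andP q01.
have npp : N * p ^+ 2 <= N * p by rewrite ler_wpM2l ?(ltW N0) // expr2 ler_piMl.
have nq2 : N * (p / 2) <= N * q by rewrite ler_wpM2l // ltW.
have nqp2 : N * q * (p / 2) <= N * q * q by rewrite ler_wpM2l // mulr_ge0 // ltW.
have npq : N * (p / 2) * p <= N * q * p by rewrite ler_wpM2r.
have nqL : 2112 * L <= N * q by move: npp nq2 np2; clear; lra.
have nqp : 2112 * L <= N * q * p.
  by move: npq np2; rewrite expr2 mulrA; clear; lra.
have nqq : 1056 * L <= N * q * q by move: nqp2 nqp; clear; lra.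
have [m m_le m_gt] : exists2 m : nat, m%:R <= N * q / 48 & N * q / 48 < m.+1%:R.
  exists (Num.truncn (N * q / 48)).
    by rewrite truncn_le // divr_ge0 ?mulr_ge0 ?(ltW N0).
  exact: truncnS_gt.
have m_ge : N * q / 96 <= m%:R.
  by move: m_gt nqL L1; rewrite -[m.+1%:R]natr1; clear; lra.
have m2 : (1 < m)%N by rewrite -(ltr_nat R); move: m_ge nqL L1; clear; lra.
have pow_le (y : R) : 0 <= y <= 1 -> (1 - y) ^+ m <= expR (- (y * (N * q / 96))).
  move=> /andP[y0 y1]; apply: (@le_trans _ _ (expR (- y) ^+ m)).
    by rewrite lerXn2r ?nnegrE ?expR_ge0 ?subr_ge0 // expR_ge1Dx.
  by rewrite -expRM_natl ler_expR mulrN lerN2 [m%:R * y]mulrC ler_wpM2l.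
have pm : (1 - p) ^+ m <= (v ^+ 11) ^+ 2.
  apply: le_trans (pow_le _ p01) _; rewrite -exprM vL ler_expR lerN2.
  have -> : (11 * 2)%:R = 22 :> R by [].
  by move: nqp; clear; lra.
have qm : (1 - q) ^+ (12 * m - 3) <= v ^+ 11.
  apply: (@le_trans _ _ ((1 - q) ^+ m)).
    by rewrite ler_wiXn2l ?subr_ge0 ?lerBlDr ?lerDl //; move: m2; clear; lia.
  by apply: le_trans (pow_le _ q01) _; rewrite vL ler_expR lerN2; move: nqq; clear; lra.
have sm : \sum_(S : {set 'I_n} | (#|S| < 12 * m)%N) bern q S <= v ^+ 11.
  apply: le_trans (bern_small_le _ _ q01) _.
  have e2 : 2 <= expR 1 :> R by apply: le_trans (expR_ge1Dx _); rewrite -[2]natr1.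
  apply: (@le_trans _ _ (expR 1 ^+ (12 * m) * expR (- (n%:R * q / 2)))).
    by rewrite ler_wpM2r ?expR_ge0 // lerXn2r ?nnegrE ?expR_ge0.
  by rewrite -expRM_natl -expRD vL ler_expR natrM mulr1 NE; move: m_le nqL L1; clear; lra.
have r01 : 0 <= v ^+ 11 <= 1 by rewrite exprn_ge0 ?exprn_ile1 ?(ltW v0).
have theta0 : 0 < v ^+ 5 by rewrite exprn_gt0.
apply: le_trans (gnp_prob2_disconnected_le p01 q01 r01 qp n0 m2 theta0 pm sm) _.
rewrite NE vE.
have vle j : (0 < j)%N -> v ^+ j <= v.
  by case: j => // j _; rewrite exprS ler_piMr ?exprn_ile1 ?(ltW v0).
set e := expR 1; have e0 : 0 <= e by apply: expR_ge0.
have T1 : (v ^+ 11 + (e * N ^+ 5 + 1) * (v ^+ 11 * expR (N * v ^+ 11))) / v ^+ 5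
    <= v + (e * v + v) * e.
  have E1 : expR (N * v ^+ 11) <= e.
    by rewrite ler_expR exprS mulrA Nv mul1r exprn_ile1 // ltW.
  have -> : (v ^+ 11 + (e * N ^+ 5 + 1) * (v ^+ 11 * expR (N * v ^+ 11))) / v ^+ 5
     = v ^+ 6 + (e * v + v ^+ 6) * expR (N * v ^+ 11).
    by rewrite -vE; field; rewrite gt_eqF.
  apply: lerD; first exact: vle.
  apply: ler_pM; rewrite ?expR_ge0 ?addr_ge0 ?mulr_ge0 ?exprn_ge0 ?(ltW v0) //.
  by rewrite lerD2l vle.
have T2 : N * v ^+ 11 <= v.
  by rewrite exprS mulrA Nv mul1r vle.
have T3 : N ^+ (n + 2) * (v ^+ 5 + 2 * (1 - q) ^+ (12 * m - 3)) ^+ (n - 2) <= v.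
  apply: (@le_trans _ _ (N ^+ (n + 2) * (v ^+ 4) ^+ (n - 2))).
    rewrite ler_wpM2l ?exprn_ge0 ?(ltW N0) // lerXn2r ?nnegrE ?addr_ge0 ?mulr_ge0 ?exprn_ge0 ?subr_ge0 ?(ltW v0) //.
    have v11 : v ^+ 11 <= v ^+ 5 by rewrite ler_wiXn2l ?(ltW v0).
    have v5 : v ^+ 5 <= 4^-1 * v ^+ 4 by rewrite exprS ler_wpM2r ?exprn_ge0 ?(ltW v0).
    have v40 : 0 <= v ^+ 4 by rewrite exprn_ge0 ?(ltW v0).
    by move: qm v11 v5 v40; clear; lra.
  have -> : (n + 2 = 4 + (n - 2))%N by move: n3; clear; lia.
  rewrite exprD -mulrA -[N ^+ (n - 2) * _]exprMn.
  have -> : N * v ^+ 4 = v ^+ 3 by rewrite exprS mulrA Nv mul1r.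
  have [k ->] : exists k, (n - 2 = k + 2)%N by exists (n - 4)%N; move: n3; clear; lia.
  rewrite exprD mulrCA.
  have -> : N ^+ 4 * (v ^+ 3) ^+ 2 = v ^+ 2 by rewrite -vE; field; rewrite gt_eqF.
  apply: le_trans (vle 2%N isT); rewrite ler_piMl ?exprn_ge0 ?exprn_ile1 ?exprn_ge0 ?(ltW v0) //.
apply: le_trans (lerD T1 (lerD T2 T3)) _.
rewrite le_eqVlt; apply/orP; left; apply/eqP; ring.
Qed.

(** With [T = (ln n)^(2/3)], the hypothesis gives [n p^2 >= exp (2 T)^2 >= T^2],
    and [T^2 = (ln n)^(4/3)] outgrows any multiple of [ln n]. *)
Lemma np2_ge_ln K p n : 0 <= K -> 1 <= ln (n%:R : R) -> K ^+ 3 <= ln (n%:R : R) ->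
  expR (2 * ln (n%:R : R) `^ (2 / 3)) / n%:R `^ (1 / 2) <= p ->
  K * ln (n%:R : R) <= n%:R * p ^+ 2.
Proof.
set L := ln _ => K0 L1 LK hp; have L0 : 0 < L by apply: lt_le_trans L1.
have N0 : 0 < n%:R :> R.
  by rewrite lt_neqAle ler0n andbT; apply: contraTneq L1 => /esym n0; rewrite /L n0 ln0 // ler10.
set T := L `^ (2 / 3) in hp; set s := n%:R `^ (1 / 2) in hp.
have s0 : 0 < s by apply: powR_gt0.
have ss : s ^+ 2 = n%:R by rewrite /s div1r powR12_sqrt ?ltW // sqr_sqrtr // ltW.
have T0 : 0 < T by apply: powR_gt0.
have ps : expR (2 * T) <= s * p by rewrite [s * p]mulrC -ler_pdivrMr.
have TL : K * L <= T ^+ 2.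
  have -> : T ^+ 2 = L * L `^ (3^-1).
    have -> : L * L `^ 3^-1 = L `^ (1 + 3^-1).
      by rewrite powRD ?gt_eqF ?implybT // powRr1 // ltW.
    by rewrite -powR_mulrn ?powR_ge0 // -powRrM; congr (_ `^ _); field.
  rewrite mulrC ler_wpM2l ?(ltW L0) //.
  apply: (@le_trans _ _ ((K ^+ 3) `^ (3^-1))).
    by rewrite -powR_mulrn // -powRrM divff ?powRr1.
  by apply: ge0_ler_powR; rewrite ?nnegrE ?invr_ge0 ?exprn_ge0 ?(ltW L0).
have eT : T <= expR (2 * T) by apply: le_trans (expR_ge1Dx _); lra.
rewrite -ss -exprMn; apply: le_trans TL _; rewrite lerXn2r ?nnegrE ?(ltW T0) //.
  by apply: le_trans ps; apply: expR_ge0.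
exact: le_trans eT ps.
Qed.

Lemma gnp_prob2_ge0 p n (Q : rel (sgraph 'I_n)) : 0 <= p <= 1 -> 0 <= gnp_prob2 p Q.
Proof.
by move=> p01; apply: sumr_ge0 => X _; apply: sumr_ge0 => Y _; rewrite mulr_ge0 ?gnp_ge0.
Qed.
End Asymptotics.

Theorem theorem1p1 (R : realType) (eps : R)
  (eps_gt0 : 0 < eps) (eps_small : eps < 2 `^ (- (1 / 2)))
  (p : nat -> R) (p01 : forall n : nat, 0 <= p n <= 1) :
  ((forall n : nat, (0 < n)%N ->
      p n <= (2 `^ (- (1 / 2)) - eps) / n%:R `^ (1 / 2)) ->
   (fun n : nat => gnp_prob2 (p n)
      (fun X Y : sgraph 'I_n => ~~ FS_connected X Y)) @ \oo --> (1 : R))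
  /\
  ((\forall n \near \oo,
      expR (2 * ln (n%:R : R) `^ (2 / 3)) / n%:R `^ (1 / 2) <= p n) ->
   (fun n : nat => gnp_prob2 (p n)
      (fun X Y : sgraph 'I_n => FS_connected X Y)) @ \oo --> (1 : R)).
Proof.
have a_sqrt : 2 `^ (- (1 / 2)) = (Num.sqrt 2)^-1 :> R.
  by rewrite powRN div1r powR12_sqrt.
rewrite a_sqrt in eps_small *; split=> hp.
  apply: cvg1_of_rate; near=> n.
  have n1 : (1 < n)%N by near: n; exact: nbhs_infty_gt.
  rewrite gnp_prob2C subKr gnp_prob2_ge0 //=.
  apply: (gnp_prob2_connected_rate eps_gt0) => //.
  by have := hp n (ltnW n1); rewrite div1r powR12_sqrt.
apply: cvg1_of_rate; near=> n.
rewrite gnp_prob2C subKr gnp_prob2_ge0 //=.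
have LK : 4224 ^+ 3 <= ln (n%:R : R).
  rewrite -ler_expR lnK; last first.
    rewrite posrE ltr0n; near: n; exact: nbhs_infty_gt.
  near: n; exact: nbhs_infty_ger.
have L1 : 1 <= ln (n%:R : R) by apply: le_trans LK; rewrite exprn_ege1 // ler1n.
apply: gnp_prob2_disconnected_rate => //; first by near: n; exact: nbhs_infty_gt.
by apply: (np2_ge_ln (ler0n _ _) L1 LK); near: n.
Unshelve. all: by end_near.
Qed.
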